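(* Let $H_0$ be a self-adjoint operator on a Hilbert space $\mathcal H$ with frame operator $F=\sum_j\kappa_j\langle\varphi_j,\cdot\rangle\psi_j$. The absolutely continuous part $H_0^{(a)}$ of $H_0$ is naturally isomorphic to the operator of multiplication by $\lambda$ on $\mathbf H$ via the unitary mapping $\mathcal E:\mathcal H^{(a)}(H_0)\to\mathbf H$: for every $f$ in the domain of $H_0$, $$\mathcal E_\lambda(H_0f)=\lambda\,\mathcal E_\lambda f\qquad\text{for a.e. }\lambda\in\mathbb R,$$ where $\mathcal E_\lambda g:=(\mathcal Eg)(\lambda)$ for $g\in\mathcal H$.
   Context: Inner products are linear in the second variable; $R_z(H)=(H-z)^{-1}$; $\operatorname{Im}T=(T-T^* )/2i$. $\mathcal H^{(a)}(H_0)$ is the absolutely continuous subspace of $H_0$ and $H_0^{(a)}$ the restriction of $H_0$ to it. Frame operator: a Hilbert–Schmidt operator $F=\sum_j\kappa_j\langle\varphi_j,\cdot\rangle\psi_j:\mathcal H\to\mathcal K$ between complex separable Hilbert spaces, with $(\kappa_j)\in\ell_2$ a decreasing sequence of positive numbers and $(\varphi_j)$, $(\psi_j)$ orthonormal bases of $\mathcal H$, $\mathcal K$. $\Lambda(H_0;F)$ is the set (of full Lebesgue measure) of $\lambda\in\mathbb R$ such that, as $y\to0^+$, $FR_{\lambda+iy}(H_0)F^*$ converges in operator norm and $F\operatorname{Im}R_{\lambda+iy}(H_0)F^*$ converges in trace-class norm. For such $\lambda$ let $\phi(\lambda)=\frac1\pi\big(\kappa_i\kappa_j\langle\varphi_i,\operatorname{Im}R_{\lambda+i0}(H_0)\varphi_j\rangle\big)_{i,j}$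 (entries being limits as $y\to0^+$), a non-negative trace-class operator on $\ell_2$; $\eta(\lambda)=\sqrt{\phi(\lambda)}$; $\eta_j(\lambda)\in\ell_2$ its $j$-th column; $\varphi_j(\lambda)=\kappa_j^{-1}\eta_j(\lambda)$; and $\mathfrak h_\lambda\subset\ell_2$ the closed linear span of $\{\varphi_j(\lambda)\}_{j\ge1}$. $\mathbf H=\int^\oplus_{\Lambda(H_0;F)}\mathfrak h_\lambda\,d\lambda$ is the direct integral with measurability base $\{\varphi_j(\cdot)\}$: it consists of (classes of a.e. equal) functions $f$ with $f(\lambda)\in\mathfrak h_\lambda$, $\lambda\mapsto\langle f(\lambda),\varphi_j(\lambda)\rangle$ measurable for all $j$, and $\int\|f(\lambda)\|^2d\lambda<\infty$. $\mathcal E:\mathcal H\to\mathbf H$ is the bounded linear operator obtained by continuity from $(\mathcal E\varphi_j)(\lambda)=\varphi_j(\lambda)$, $j=1,2,\dots$; it vanishes on the singular subspace of $H_0$ and is unitary from $\mathcal H^{(a)}(H_0)$ onto $\mathbf H$. *)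

(* Defs.v *)
From HB Require Import structures.
From mathcomp Require Export all_boot all_order all_algebra.
From mathcomp Require Export all_classical all_reals all_analysis.
From mathcomp Require Export complex.

Export Order.TTheory GRing.Theory Num.Theory.
Export numFieldNormedType.Exports.

Set Implicit Arguments.
Unset Strict Implicit.
Unset Printing Implicit Defensive.

Local Open Scope classical_set_scope.
Local Open Scope ring_scope.
Local Open Scope complex_scope.

(* Complex Hilbert spaces.  The norm of a normed module over [R[i]] takes its
   values in the nonnegative elements of [R[i]]; [rnorm] is the same number
   seen in [R].  The inner product is linear in its second variable. *)

HB.mixin Record CompleteNormedModule_isHilbert (R : realType) (V : Type)
    of CompleteNormedModule R[i] V := {
  inner : V -> V -> R[i] ;
  innerDr : forall x y z : V, inner x (y + z) = inner x y + inner x z ;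
  innerZr : forall (a : R[i]) (x y : V), inner x (a *: y) = a * inner x y ;
  inner_conj : forall x y : V, inner x y = (inner y x)^* ;
  inner_norm : forall x : V, inner x x = `|x| ^+ 2
}.

#[short(type="hilbertType")]
HB.structure Definition Hilbert (R : realType) :=
  {V of CompleteNormedModule_isHilbert R V & CompleteNormedModule R[i] V}.

Definition rnorm (R : realType) (V : normedModType R[i]) (x : V) : R :=
  complex.Re `|x|.

Definition orthonormal_basis (R : realType) (V : hilbertType R) (e : nat -> V) :=
  (forall i j, inner (e i) (e j) = (i == j)%:R) /\
  (forall x, series (fun j => inner (e j) x *: e j) @ \oo --> x).

(* Everywhere defined operators. *)

Definition op_norm (R : realType) (V W : hilbertType R) (T : V -> W) : \bar R :=
  ereal_sup [set (rnorm (T x))%:E | x in [set x : V | rnorm x <= 1]].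

Definition bounded_op (R : realType) (V W : hilbertType R) (T : V -> W) :=
  linear T /\ (op_norm T < +oo)%E.

Definition adjoint (R : realType) (V W : hilbertType R) (T : V -> W) : W -> V :=
  xget (fun=> 0) [set S | forall x y, inner (T x) y = inner x (S y)].

Definition im_op (R : realType) (V : hilbertType R) (T : V -> V) : V -> V :=
  fun x => (2 * 'i)^-1 *: (T x - adjoint T x).

(* The positive square root of [A]; it is unique if it exists. *)
Definition sqrt_op (R : realType) (V : hilbertType R) (A : V -> V) : V -> V :=
  xget (fun=> 0) [set B | [/\ bounded_op B,
    forall x, 0 <= inner x (B x) & forall x, B (B x) = A x]].

(* [trace_norm e T] is the trace of [|T| = sqrt (T^* T)], computed in the
   orthonormal basis [e]; the value does not depend on [e]. *)
Definition trace_norm (R : realType) (V : hilbertType R) (e : nat -> V)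
    (T : V -> V) : \bar R :=
  (\sum_(0 <= j <oo)
     (complex.Re (inner (e j) (sqrt_op (adjoint T \o T) (e j))))%:E)%E.

(* Unbounded operators: [op_fun] is meaningful on [op_dom] only. *)

Record operator (R : realType) (V : hilbertType R) := Operator {
  op_dom : set V ;
  op_fun :> V -> V ;
  op_dom0 : op_dom 0 ;
  op_domP : forall (a : R[i]) x y,
    op_dom x -> op_dom y -> op_dom (a *: x + y) ;
  op_linear : forall (a : R[i]) x y,
    op_dom x -> op_dom y -> op_fun (a *: x + y) = a *: op_fun x + op_fun y
}.

(* Density of the domain, and equality of the graphs of [A^*] and [A]. *)
Definition self_adjoint (R : realType) (V : hilbertType R) (A : operator V) :=
  dense (op_dom A) /\
  (forall y z, (forall x, op_dom A x -> inner (A x) y = inner x z) <->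
               (op_dom A y /\ A y = z)).

Definition resolvent (R : realType) (V : hilbertType R) (A : operator V)
    (z : R[i]) : V -> V :=
  fun x => xget 0 [set y | op_dom A y /\ A y - z *: y = x].

(* Spectral measures and the absolutely continuous subspace. *)

Definition projection_valued_measure (R : realType) (V : hilbertType R)
    (P : set (measurableTypeR R) -> V -> V) :=
  [/\ forall D, measurable D -> linear (P D),
      forall D, measurable D -> forall x, P D (P D x) = P D x,
      forall D, measurable D -> forall x y, inner (P D x) y = inner x (P D y),
      forall x, P setT x = x
    & forall D : nat -> set (measurableTypeR R), (forall n, measurable (D n)) ->
      trivIset setT D -> forall x,
      series (fun n => P (D n) x) @ \oo --> P (\bigcup_n D n) x].

Definition measure_at (R : realType) (V : hilbertType R)
    (P : set (measurableTypeR R) -> V -> V) (x : V)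
    : set (measurableTypeR R) -> \bar R :=
  fun D => (complex.Re (inner x (P D x)))%:E.

(* [A] is the integral of [l] against [P]. *)
Definition spectral_measure (R : realType) (V : hilbertType R) (A : operator V)
    (P : set (measurableTypeR R) -> V -> V) :=
  projection_valued_measure P /\
  forall x,
    (op_dom A x <-> (\int[measure_at P x]_l ((l : R) ^+ 2)%:E < +oo)%E) /\
    (op_dom A x ->
       inner x (A x) = (fine (\int[measure_at P x]_l (l : R)%:E))%:C).

(* By the spectral theorem a self-adjoint operator has exactly one spectral
   measure, so that the quantifier over [P] only names it. *)
Definition ac_subspace (R : realType) (V : hilbertType R) (A : operator V)
    : set V :=
  [set x | forall P, spectral_measure A P ->
     measure_at P x `<< lebesgue_measure].

Definition singular_subspace (R : realType) (V : hilbertType R) (A : operator V)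
    : set V :=
  [set x | forall y, ac_subspace A y -> inner y x = 0].

(* Frame operators; the sequences are indexed from 0. *)

Record frame (R : realType) (V W : hilbertType R) := Frame {
  kappa : nat -> R ;
  phi : nat -> V ;
  psi : nat -> W ;
  kappa_gt0 : forall j, 0 < kappa j ;
  kappa_nonincr : forall i j, (i <= j)%N -> kappa j <= kappa i ;
  kappa_l2 : cvgn (series (fun j => kappa j ^+ 2)) ;
  phi_basis : orthonormal_basis phi ;
  psi_basis : orthonormal_basis psi
}.

Definition frame_op (R : realType) (V W : hilbertType R) (F : frame V W)
    : V -> W :=
  fun x => limn (series (fun j =>
    ((kappa F j)%:C * inner (phi F j) x) *: psi F j)).

(* [F T F^*] *)
Definition sandwich (R : realType) (V W : hilbertType R) (F : frame V W)
    (T : V -> V) : W -> W :=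
  frame_op F \o T \o adjoint (frame_op F).

Definition Lambda (R : realType) (V W : hilbertType R) (A : operator V)
    (F : frame V W) : set R :=
  [set l |
    (exists2 T, bounded_op T &
       op_norm (fun x => sandwich F (resolvent A (l +i* y)) x - T x)
         @[y --> 0^'+] --> 0%E) /\
    (exists2 S, bounded_op S /\ (trace_norm (psi F) S < +oo)%E &
       trace_norm (psi F)
         (fun x => sandwich F (im_op (resolvent A (l +i* y))) x - S x)
         @[y --> 0^'+] --> 0%E)].

(* Vectors and operators of l^2: sequences and infinite matrices. *)

Definition l2_normsq (R : realType) (v : nat -> R[i]) : \bar R :=
  (\sum_(0 <= k <oo) (complex.Re (`|v k| ^+ 2))%:E)%E.

Definition l2_inner (R : realType) (u v : nat -> R[i]) : R[i] :=
  limn (series (fun k => ((u k)^* * v k : R[i]^o))).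

Definition l2_closed_span (R : realType) (v : nat -> nat -> R[i])
    : set (nat -> R[i]) :=
  [set u | (l2_normsq u < +oo)%E /\
     forall e : R, 0 < e -> exists (n : nat) (c : nat -> R[i]),
       (l2_normsq (fun k => (u k - \sum_(j < n) c j * v j k)%R) < e%:E)%E].

(* The matrix of the nonnegative square root of a bounded operator of matrix
   [M].  Positivity is tested on finitely supported vectors, which suffices
   because they are dense and [B] is bounded: positivity makes [B] Hermitian,
   whence [|B c|^2 = <c, M c>]. *)
Definition sqrt_mat (R : realType) (M : nat -> nat -> R[i])
    : nat -> nat -> R[i] :=
  xget (fun _ _ => 0) [set B : nat -> nat -> R[i] |
    (forall n (c : nat -> R[i]),
       0 <= \sum_(i < n) \sum_(j < n) (c i)^* * B i j * c j) /\
    (forall i j, series (fun k => (B i k * B k j : R[i]^o)) @ \oo -->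
       (M i j : R[i]^o))].

Section Fibers.
Context (R : realType) (V W : hilbertType R) (A : operator V) (F : frame V W).

Definition phi_mat (l : R) : nat -> nat -> R[i] := fun i j =>
  (pi^-1)%:C * ((kappa F i)%:C * (kappa F j)%:C *
    lim ((inner (phi F i) (im_op (resolvent A (l +i* y)) (phi F j)) : R[i]^o)
           @[y --> 0^'+])).

Definition eta_mat (l : R) : nat -> nat -> R[i] := sqrt_mat (phi_mat l).

(* The vector [phi_j(l)] for [l] in [Lambda], extended by 0 to the real line;
   consequently [fiber l] is {0} outside [Lambda] and the sections of the
   direct integral are the functions on [Lambda], extended by 0. *)
Definition phi_at (j : nat) (l : R) : nat -> R[i] := fun k =>
  if `[< Lambda A F l >] then ((kappa F j)^-1)%:C * eta_mat l k j else 0.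

Definition fiber (l : R) : set (nat -> R[i]) :=
  l2_closed_span (fun j => phi_at j l).

(* Square-integrable measurable sections: representatives of the elements of
   the direct integral, in which equality is equality almost everywhere. *)
Definition direct_integral : set (R -> nat -> R[i]) :=
  [set f | [/\ forall l, fiber l (f l),
    forall j,
      measurable_fun setT (fun l : measurableTypeR R =>
        complex.Re (l2_inner (f l) (phi_at j l))) /\
      measurable_fun setT (fun l : measurableTypeR R =>
        complex.Im (l2_inner (f l) (phi_at j l)))
    & (\int[lebesgue_measure]_l l2_normsq (f l) < +oo)%E]].

(* [E] is a bounded linear operator from [V] to the direct integral which maps
   [phi F j] to [phi_at j]; it is determined up to equality a.e. *)
Definition evaluation_operator (E : V -> R -> nat -> R[i]) :=
  [/\ forall g, direct_integral (E g),
      forall (a : R[i]) g h,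
        {ae lebesgue_measure, forall l : R, E (a *: g + h) l =
           (fun k => a * E g l k + E h l k)},
      exists M : R, forall g,
        (\int[lebesgue_measure]_l l2_normsq (E g l) <= (M * rnorm g ^+ 2)%:E)%E
    & forall j, {ae lebesgue_measure, forall l : R, E (phi F j) l = phi_at j l}].

Definition multiply (f : R -> nat -> R[i]) : R -> nat -> R[i] :=
  fun l k => l%:C * f l k.

Definition multiply_dom : set (R -> nat -> R[i]) :=
  [set f | direct_integral f /\ direct_integral (multiply f)].

(* [E] vanishes on the singular subspace and is unitary from the absolutely
   continuous subspace onto the direct integral. *)
Definition unitary_on_ac (E : V -> R -> nat -> R[i]) :=
  [/\ forall g, singular_subspace A g ->
        {ae lebesgue_measure, forall l : R, E g l = (fun=> 0)},
      forall g, ac_subspace A g ->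
        (\int[lebesgue_measure]_l l2_normsq (E g l) = (rnorm g ^+ 2)%:E)%E
    & forall f, direct_integral f -> exists2 g, ac_subspace A g &
        {ae lebesgue_measure, forall l : R, E g l = f l}].

End Fibers.

(* Main.v *)
(* Write R_z for the resolvent of H0.  The Poisson form
   u_y(f, g)(l) = <f, Im R_{l+iy} g> has the boundary values
   pi <E_l phi_i, E_l phi_j> on the frame vectors, and on the domain of H0 it
   satisfies u_y(H0 f, phi_j)(l) - l u_y(f, phi_j)(l) -> 0 as y -> 0, because
   R_z H0 f = f + z R_z f.  To pass from finite combinations of the phi_j to an
   arbitrary f in the domain one needs an L^1 bound on the densities of the
   error h of approximation, which is obtained without the spectral theorem.
   The combination w_y = u_y - u_{2y} / 2 has the same limits, up to the factor
   1/2, and w_y(h, h)(l) = 3 y^3 |R_{l+iy} R_{l+2iy} h|^2.  The operators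
   y^2 R_{l+iy} R_{l+2iy}, for l in an arithmetic progression of step y, are
   almost orthogonal, so that Schur's test bounds the integral of w_y(h, h) over
   bounded intervals by a multiple of |h|^2, uniformly in y.  Fatou's lemma then
   gives <E_l (H0 f), phi_j(l)> = l <E_l f, phi_j(l)> a.e., and the phi_j(l)
   span the fiber.

   For the domain of H0 on the absolutely continuous subspace: if f and g are
   absolutely continuous and E_l g = l E_l f a.e., then E (g + i f) and
   E (g - i f) have the same norm, whence <g, f> is real.  By polarization
   <H0 x, f> = <x, g> for all x in the domain of H0, and g = H0 f since H0 is
   self-adjoint.  *)

Require Import Defs.
From mathcomp Require Import measurable_realfun ring lra.

Set Implicit Arguments.
Unset Strict Implicit.
Unset Printing Implicit Defensive.

Local Open Scope classical_set_scope.
Local Open Scope ring_scope.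
Local Open Scope complex_scope.

(** * Norms and moduli as real numbers *)

(** On [Lambda] only the entries [u_y(phi_i, phi_j)] are shown to converge; [u_y(f, phi_j)] and
    [u_y(H0 f, phi_j)] need not, and the combinations approximating [f] may lie outside the domain
    of [H0]. The error of approximation must therefore be estimated at positive y, before any limit
    is taken. The norm of [R_{l+iy} R_{l'-iy}] decays like [1 / |l - l'|] only, and the sums in
    Schur's test would diverge logarithmically. The two scales y and 2y supply two such factors, and
    [1 / (l - l')^2] is summable. The estimate is restricted to [[-N, N)], where multiplication by l
    is bounded, and to one j at a time. Cauchy-Schwarz for [w_y] brings in [w_y(phi_j, phi_j)(l)],
    whose limit [(pi / 2) |phi_j(l)|^2] is finite but may be unbounded in l. Dividing by 1 plus this
    limit keeps the bounds integrable; this is the origin of [weight]. The constant 768 is 3 * 4^2 *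
    16: 3 from the formula for [w_y(h, h)], 4^2 from comparing the points of a cell of length y, 16
    from Schur's test. *)

Section RealNorm.
Context (R : realType) (V : normedModType R[i]).
Implicit Types (x y : V) (a : R[i]).

Lemma rnormE x : `|x| = (rnorm x)%:C.
Proof. by rewrite RRe_real// ger0_real. Qed.

Lemma rnorm_ge0 x : 0 <= rnorm x.
Proof. by rewrite -ler0c -rnormE. Qed.

Lemma rnorm0 : rnorm (0 : V) = 0.
Proof. by rewrite /rnorm normr0. Qed.

Lemma rnorm0_eq0 x : rnorm x = 0 -> x = 0.
Proof. by move=> h; apply/normr0_eq0; rewrite rnormE h. Qed.

Lemma rnormN x : rnorm (- x) = rnorm x.
Proof. by rewrite /rnorm normrN. Qed.

Lemma rdistrC x y : rnorm (x - y) = rnorm (y - x).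
Proof. by rewrite -rnormN opprB. Qed.

Lemma ler_rnormD x y : rnorm (x + y) <= rnorm x + rnorm y.
Proof. by rewrite -lecR rmorphD/= -!rnormE ler_normD. Qed.

Lemma ler_rnormB x y : rnorm (x - y) <= rnorm x + rnorm y.
Proof. by rewrite (le_trans (ler_rnormD _ _))// rnormN. Qed.

Lemma rnormZ a x : rnorm (a *: x) = rnorm (a : R[i]^o) * rnorm x.
Proof. by apply: complexI; rewrite rmorphM/= -!rnormE normrZ. Qed.

(** Positive elements of [R[i]] are real, so the radii of the balls of [V] come from positive
    elements of [R]. *)
Lemma cvg_rnormP (T : Type) (F : set_system T) {FF : Filter F} (f : T -> V) x :
  f @ F --> x <-> rnorm (f t - x) @[t --> F] --> (0 : R).
Proof.
split=> [/cvgrPdist_lt h|/cvgrPdist_lt h]; apply/cvgrPdist_lt => e e0.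
  have := h e%:C; rewrite ltcR => /(_ e0); apply: filterS => t.
  by rewrite rnormE ltcR sub0r normrN ger0_norm ?rnorm_ge0// rdistrC.
have [e1 e1E] : exists e1 : R, e = e1%:C.
  by exists (complex.Re e); rewrite RRe_real// gtr0_real.
rewrite e1E in e0 *; rewrite ltcR in e0.
have := h e1 e0; apply: filterS => t.
by rewrite rnormE ltcR sub0r normrN ger0_norm ?rnorm_ge0// rdistrC.
Qed.

Lemma cvg_rnorm (T : Type) (F : set_system T) {FF : Filter F} (f : T -> V) x :
  f @ F --> x -> rnorm (f t) @[t --> F] --> rnorm x.
Proof.
move=> /cvg_rnormP/cvgrPdist_lt h; apply/cvgrPdist_lt => e /h.
apply: filterS => t; rewrite sub0r normrN => ?.
apply: le_lt_trans; last by eassumption.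
rewrite (ger0_norm (rnorm_ge0 (f t - x))) ler_norml; apply/andP; split.
  rewrite lerNl opprB lerBlDr; apply: le_trans (ler_rnormD _ _).
  by rewrite subrK.
rewrite lerBlDr rdistrC; apply: le_trans (ler_rnormD _ _).
by rewrite subrK.
Qed.

End RealNorm.

(** [R[i]^o] is [R[i]] as a normed module over itself, so that the lemmas on [rnorm] apply to
    moduli. *)
Notation cabs c := (rnorm (c : _[i]^o)).

Section ComplexModulus.
Context (R : realType).
Implicit Types (a b : R[i]).

Lemma cabsE a : `|a| = (cabs a)%:C.
Proof. exact: (@rnormE R (R[i]^o)). Qed.

Lemma cabsM a b : cabs (a * b) = cabs a * cabs b.
Proof. by apply: complexI; rewrite rmorphM/= -!cabsE normrM. Qed.

Lemma cabs_eq0 a : cabs a = 0 -> a = 0.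
Proof. exact: (@rnorm0_eq0 R R[i]^o). Qed.

Lemma cabsN a : cabs (- a) = cabs a.
Proof. exact: (@rnormN R R[i]^o). Qed.

Lemma ler_cabsD a b : cabs (a + b) <= cabs a + cabs b.
Proof. exact: (@ler_rnormD R R[i]^o). Qed.

Lemma cabsJ a : cabs (conjc a) = cabs a.
Proof. by apply: complexI; rewrite -!cabsE normcJ. Qed.

Lemma cabsR (r : R) : cabs r%:C = `|r|.
Proof. by apply: complexI; rewrite -cabsE normc_def/= expr0n addr0 sqrtr_sqr. Qed.

Lemma cabs_sqr a : cabs a ^+ 2 = complex.Re a ^+ 2 + complex.Im a ^+ 2.
Proof. by apply: complexI; rewrite rmorphXn/= -cabsE -add_Re2_Im2. Qed.

Lemma conjE a : Num.conj a = conjc a.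
Proof. by []. Qed.

Lemma mulJc a : conjc a * a = (cabs a ^+ 2)%:C.
Proof. by rewrite mulrC -sqr_normc cabsE rmorphXn. Qed.

Lemma ReM_real (r : R) a : complex.Re (r%:C * a) = r * complex.Re a.
Proof. by case: a => x y /=; rewrite mul0r subr0. Qed.

Lemma ImM_real (r : R) a : complex.Im (r%:C * a) = r * complex.Im a.
Proof. by case: a => x y /=; rewrite mul0r addr0. Qed.

Lemma ReJ a : complex.Re (conjc a) = complex.Re a. Proof. by case: a. Qed.
Lemma ImJ a : complex.Im (conjc a) = - complex.Im a. Proof. by case: a. Qed.

Lemma real_complexM (r s : R) : (r * s)%:C = r%:C * s%:C.
Proof. exact: rmorphM. Qed.

Lemma conjcM a b : conjc (a * b) = conjc a * conjc b.
Proof. exact: rmorphM. Qed.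

Lemma conjcD a b : conjc (a + b) = conjc a + conjc b.
Proof. exact: rmorphD. Qed.

Lemma conjcN a : conjc (- a) = - conjc a.
Proof. exact: rmorphN. Qed.

Lemma ReD a b : complex.Re (a + b) = complex.Re a + complex.Re b.
Proof. by case: a; case: b. Qed.
Lemma ImD a b : complex.Im (a + b) = complex.Im a + complex.Im b.
Proof. by case: a; case: b. Qed.
Lemma ReN a : complex.Re (- a) = - complex.Re a. Proof. by case: a. Qed.
Lemma ImN a : complex.Im (- a) = - complex.Im a. Proof. by case: a. Qed.

Lemma Re_sum n (f : nat -> R[i]) :
  complex.Re (\sum_(0 <= i < n) f i) = \sum_(0 <= i < n) complex.Re (f i).
Proof.
elim: n => [|n ih]; first by rewrite !big_nil.
by rewrite !big_nat_recr//= ReD ih.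
Qed.

Lemma Im_sum n (f : nat -> R[i]) :
  complex.Im (\sum_(0 <= i < n) f i) = \sum_(0 <= i < n) complex.Im (f i).
Proof.
elim: n => [|n ih]; first by rewrite !big_nil.
by rewrite !big_nat_recr//= ImD ih.
Qed.

Lemma Re_le_cabs a : `|complex.Re a| <= cabs a.
Proof.
by rewrite -(@ler_pXn2r _ 2)// ?nnegrE ?rnorm_ge0// cabs_sqr real_normK ?num_real//;
  rewrite lerDl sqr_ge0.
Qed.

Lemma Im_le_cabs a : `|complex.Im a| <= cabs a.
Proof.
by rewrite -(@ler_pXn2r _ 2)// ?nnegrE ?rnorm_ge0// cabs_sqr real_normK ?num_real//;
  rewrite lerDr sqr_ge0.
Qed.

Lemma cabs_le_Re_Im a : cabs a <= `|complex.Re a| + `|complex.Im a|.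
Proof.
rewrite -(@ler_pXn2r _ 2)// ?nnegrE ?addr_ge0 ?rnorm_ge0//.
rewrite cabs_sqr sqrrD !real_normK ?num_real// -addrA lerD2l.
by rewrite lerDr mulrn_wge0// mulr_ge0.
Qed.

Lemma cvg_complexP (T : Type) (F : set_system T) {FF : Filter F}
    (f : T -> R[i]) a :
  (f : T -> R[i]^o) @ F --> (a : R[i]^o) <->
  (complex.Re (f t) @[t --> F] --> complex.Re a) /\
  (complex.Im (f t) @[t --> F] --> complex.Im a).
Proof.
split=> [/cvg_rnormP/cvgrPdist_lt h|[/cvgrPdist_lt h1 /cvgrPdist_lt h2]].
  split; apply/cvgrPdist_lt => e /h; apply: filterS => t;
    rewrite sub0r normrN ger0_norm ?rnorm_ge0// => ?;
    (apply: le_lt_trans; last by eassumption); rewrite rdistrC.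
    by apply: le_trans (Re_le_cabs _); rewrite ReD ReN.
  by apply: le_trans (Im_le_cabs _); rewrite ImD ImN.
apply/cvg_rnormP/cvgrPdist_lt => e e0.
have e20 : 0 < e / 2 by rewrite divr_gt0.
near=> t; rewrite sub0r normrN ger0_norm ?rnorm_ge0//.
apply: le_lt_trans (cabs_le_Re_Im _) _; rewrite ReD ImD ReN ImN.
rewrite (splitr e) ltrD//.
  by rewrite distrC; near: t; exact: h1.
by rewrite distrC; near: t; exact: h2.
Unshelve. all: by end_near. Qed.

Lemma complex_cvgMl (T : Type) (F : set_system T) {FF : Filter F}
    (c : R[i]) (f : T -> R[i]) a :
  (f : T -> R[i]^o) @ F --> (a : R[i]^o) ->
  (fun t => c * f t : R[i]^o) @ F --> (c * a : R[i]^o).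
Proof. by move=> h; exact: (@cvgZl_tmp _ R[i]^o). Qed.

Lemma complex_cvg_sum (T : Type) (F : set_system T) {FF : Filter F}
    (f : nat -> T -> R[i]) (a : nat -> R[i]) n :
  (forall i, (f i : T -> R[i]^o) @ F --> (a i : R[i]^o)) ->
  (fun t => \sum_(0 <= i < n) f i t : R[i]^o) @ F -->
  (\sum_(0 <= i < n) a i : R[i]^o).
Proof.
move=> fa; have sum_cvg (g : nat -> T -> R) (b : nat -> R) :
    (forall i, g i @ F --> b i) ->
    \sum_(0 <= i < n) g i t @[t --> F] --> \sum_(0 <= i < n) b i.
  by move=> gb; apply: cvg_big => // x; exact: add_continuous.
apply/cvg_complexP; rewrite Re_sum Im_sum; split.
  under eq_cvg do rewrite Re_sum.
  by apply: sum_cvg => i; have /cvg_complexP[] := fa i.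
under eq_cvg do rewrite Im_sum.
by apply: sum_cvg => i; have /cvg_complexP[] := fa i.
Qed.

Lemma complex_cvg_unique (T : Type) (F : set_system T) {FF : ProperFilter F}
    (f : T -> R[i]) a b :
  (f : T -> R[i]^o) @ F --> (a : R[i]^o) ->
  (f : T -> R[i]^o) @ F --> (b : R[i]^o) -> a = b.
Proof. exact: (@cvg_unique _ (@norm_hausdorff _ R[i]^o)). Qed.

End ComplexModulus.

(** * Hilbert spaces and frames *)

Section InnerProduct.
Context (R : realType) (V : hilbertType R).
Implicit Types (x y z : V) (a : R[i]).

Lemma innerDl x y z : inner (x + y) z = inner x z + inner y z.
Proof. by rewrite inner_conj innerDr rmorphD/= -!inner_conj. Qed.

Lemma innerZl a x y : inner (a *: x) y = conjc a * inner x y.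
Proof. by rewrite inner_conj innerZr rmorphM/= -inner_conj. Qed.

Lemma inner0r x : inner x 0 = 0.
Proof. by rewrite -(scale0r (0 : V)) innerZr mul0r. Qed.

Lemma inner0l x : inner 0 x = 0.
Proof. by rewrite inner_conj inner0r conjc0. Qed.

Lemma innerNr x y : inner x (- y) = - inner x y.
Proof. by rewrite -scaleN1r innerZr mulN1r. Qed.

Lemma innerNl x y : inner (- x) y = - inner x y.
Proof. by rewrite inner_conj innerNr rmorphN/= -inner_conj. Qed.

Lemma innerBr x y z : inner x (y - z) = inner x y - inner x z.
Proof. by rewrite innerDr innerNr. Qed.

Lemma innerBl x y z : inner (x - y) z = inner x z - inner y z.
Proof. by rewrite innerDl innerNl. Qed.

Lemma inner_sumr (I : Type) (s : seq I) (P : pred I) (f : I -> V) x :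
  inner x (\sum_(i <- s | P i) f i) = \sum_(i <- s | P i) inner x (f i).
Proof.
by elim/big_rec2: _ => [|i u v _ <-]; rewrite ?inner0r// innerDr.
Qed.

Lemma inner_suml (I : Type) (s : seq I) (P : pred I) (f : I -> V) x :
  inner (\sum_(i <- s | P i) f i) x = \sum_(i <- s | P i) inner (f i) x.
Proof.
by elim/big_rec2: _ => [|i u v _ <-]; rewrite ?inner0l// innerDl.
Qed.

Lemma innerxx x : inner x x = (rnorm x ^+ 2)%:C.
Proof. by rewrite inner_norm rnormE rmorphXn. Qed.

Lemma rnorm_sqrD x y :
  rnorm (x + y) ^+ 2 = rnorm x ^+ 2 + rnorm y ^+ 2 + 2 * complex.Re (inner x y).
Proof.
apply: complexI; rewrite -innerxx innerDl !innerDr !innerxx.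
rewrite (inner_conj y x) !rmorphD/= rmorphM/=.
by case: (inner x y) => p q; apply/eqP; rewrite eq_complex/=; apply/andP; split;
  apply/eqP; ring.
Qed.

Lemma rnorm_sqrB x y :
  rnorm (x - y) ^+ 2 = rnorm x ^+ 2 + rnorm y ^+ 2 - 2 * complex.Re (inner x y).
Proof. by rewrite rnorm_sqrD rnormN innerNr ReN mulrN. Qed.

Lemma parallelogram x y :
  rnorm (x + y) ^+ 2 + rnorm (x - y) ^+ 2 = 2 * rnorm x ^+ 2 + 2 * rnorm y ^+ 2.
Proof. by rewrite rnorm_sqrD rnorm_sqrB; ring. Qed.

Lemma cauchy_schwarz x y : cabs (inner x y) <= rnorm x * rnorm y.
Proof.
have [->|y0] := eqVneq y 0; first by rewrite inner0r !rnorm0 mulr0.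
have ny : 0 < rnorm y.
  by rewrite lt_def rnorm_ge0 andbT; apply: contra_neq y0; exact: rnorm0_eq0.
rewrite -(@ler_pXn2r _ 2)// ?nnegrE ?mulr_ge0 ?rnorm_ge0//.
(* [|y|^2 x - <y, x> y] is [|y|^2] times the component of [x] orthogonal to [y]; its squared norm is
   [|y|^2 (|x|^2 |y|^2 - |<x, y>|^2)]. *)
set t := (rnorm y ^+ 2)%:C; set a := inner y x.
have := sqr_ge0 (rnorm (t *: x - a *: y)).
rewrite rnorm_sqrB !rnormZ innerZl innerZr (inner_conj x y) -/a /t conjc_real.
rewrite (mulrC a) mulJc ReM_real /= cabsR ger0_norm ?sqr_ge0// cabsJ => h.
rewrite -(ler_pM2l (exprn_gt0 2 ny)) -subr_ge0.
by apply: le_trans h _; rewrite le_eqVlt; apply/orP; left; apply/eqP; ring.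
Qed.

Lemma inner_eq0 x : (forall y, inner y x = 0) -> x = 0.
Proof.
move=> /(_ x); rewrite innerxx => /eqP; rewrite eq_complex/= eqxx andbT.
by rewrite expf_eq0/= => /eqP; exact: rnorm0_eq0.
Qed.

Lemma inner_inj x x' : (forall y, inner y x = inner y x') -> x = x'.
Proof.
by move=> h; apply/subr0_eq/inner_eq0 => y; rewrite innerBr h subrr.
Qed.

Lemma cvg_innerr (T : Type) (F : set_system T) {FF : Filter F} (f : T -> V) x y :
  f @ F --> x -> (inner y (f t) : R[i]^o) @[t --> F] --> (inner y x : R[i]^o).
Proof.
move=> /cvg_rnormP h; apply/cvg_rnormP.
apply: (@squeeze_cvgr _ _ _ _ (fun=> 0) (fun t => rnorm y * rnorm (f t - x))).
- by near=> t; rewrite rnorm_ge0/= -innerBr cauchy_schwarz.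
- exact: cvg_cst.
- by rewrite -(mulr0 (rnorm y)); apply: cvgM h; exact: cvg_cst.
Unshelve. all: by end_near. Qed.

Lemma hilbert_cauchy (u : nat -> V) :
  (forall e : R, 0 < e -> exists N, forall m n, (N <= m)%N -> (N <= n)%N ->
    rnorm (u m - u n) < e) -> cvgn u.
Proof.
move=> h; apply: cauchy_cvg; apply: cauchy_exP => e e0.
have [r eE] : exists r : R, e = r%:C.
  by exists (complex.Re e); rewrite RRe_real// gtr0_real.
rewrite {}eE ltcR in e0 *; have [N hN] := h _ e0.
exists (u N); suff : \forall n \near \oo, ball (u N) r%:C (u n) by [].
near=> n.
rewrite -ball_normE/= rnormE ltcR hN//.
by near: n; exact: nbhs_infty_ge.
Unshelve. all: by end_near. Qed.

End InnerProduct.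

(** The midpoint of two terms of a minimizing sequence stays in [S], so the parallelogram identity
    makes the sequence Cauchy. The lemma serves for the range of [A - z] and for the absolutely
    continuous subspace. *)
Lemma orthogonal_projection (R : realType) (V : hilbertType R) (S : set V) :
  S 0 -> (forall (a : R[i]) x y, S x -> S y -> S (a *: x + y)) ->
  (forall (u : nat -> V) x, (forall n, S (u n)) -> u @ \oo --> x -> S x) ->
  forall x, exists2 p, S p & forall s, S s -> inner s (x - p) = 0.
Proof.
move=> S0 Slin Scl x.
pose D := [set rnorm (x - s) ^+ 2 | s in S].
have D0 : D !=set0 by exists (rnorm (x - 0) ^+ 2), 0.
have lbD : lbound D 0 by move=> _ [s _ <-]; exact: sqr_ge0.
have hasD : has_inf D by split => //; exists 0.
set d := inf D.
have dle s : S s -> d <= rnorm (x - s) ^+ 2.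
  by move=> Ss; apply: ge_inf; [exists 0|exists s].
have ex n : exists s, S s /\ rnorm (x - s) ^+ 2 < d + n.+1%:R^-1.
  have n0 : (0 : R) < n.+1%:R^-1 by rewrite invr_gt0.
  by have [_ [s Ss <-] h] := inf_adherent n0 hasD; exists s.
have [u hu] := choice ex.
have Su n := (hu n).1; have du n := (hu n).2.
have diff m n : rnorm (u m - u n) ^+ 2 <= 2 * m.+1%:R^-1 + 2 * n.+1%:R^-1.
  have Sh : S (2^-1 *: (u m + u n)).
    rewrite scalerDr; apply: (Slin); first exact: Su.
    by rewrite -[_ *: _]addr0; apply: Slin.
  have := parallelogram (x - u n) (x - u m).
  have -> : x - u n - (x - u m) = u m - u n by rewrite opprB addrC addrA subrK.
  have -> : x - u n + (x - u m) = 2 *: (x - 2^-1 *: (u m + u n)).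
    rewrite scalerBr scalerA divff ?pnatr_eq0// scale1r scaler_nat mulr2n.
    by rewrite addrACA opprD [- u n + _]addrC.
  rewrite rnormZ (_ : cabs 2 = 2 :> R); last first.
    by apply: complexI; rewrite -cabsE normr_nat rmorph_nat.
  have := dle _ Sh; have := du m; have := du n.
  rewrite exprMn; move: (m.+1%:R^-1 : R) (n.+1%:R^-1 : R) => im jn; lra.
have cu : cvgn u.
  apply: hilbert_cauchy => e e0.
  have e20 : 0 < e ^+ 2 / 4 by rewrite divr_gt0// exprn_gt0.
  have [N hN] : exists N : nat, N.+1%:R^-1 < e ^+ 2 / 4.
    have : \forall n \near \oo, n.+1%:R^-1 < e ^+ 2 / 4.
      exact: (near_infty_natSinv_lt (PosNum e20)).
    by case=> N _ /(_ N (leqnn _)); exists N.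
  exists N => m n Nm Nn.
  rewrite -(@ltr_pXn2r _ 2)// ?nnegrE ?rnorm_ge0 ?(ltW e0)//.
  apply: le_lt_trans (diff m n) _.
  have le k : (N <= k)%N -> k.+1%:R^-1 <= N.+1%:R^-1 :> R.
    by move=> Nk; rewrite lef_pV2 ?posrE// ler_nat.
  have := le _ Nm; have := le _ Nn.
  move: (m.+1%:R^-1 : R) (n.+1%:R^-1 : R) (N.+1%:R^-1 : R) hN => im jn iN.
  lra.
pose p := limn u.
have Sp : S p by apply: (Scl u) => //; exact: cu.
have dp : rnorm (x - p) ^+ 2 <= d.
  have h1 : rnorm (x - u n) ^+ 2 @[n --> \oo] --> rnorm (x - p) ^+ 2.
    by apply: (cvgM (cvg_rnorm _) (cvg_rnorm _)); apply: cvgB cu; exact: cvg_cst.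
  have h2 : d + n.+1%:R^-1 @[n --> \oo] --> d + 0.
    by apply: cvgD; [exact: cvg_cst|exact: cvg_harmonic].
  rewrite addr0 in h2.
  by apply: (ler_cvg_to h1 h2); near=> n; exact/ltW/du.
exists p => // s Ss.
set b := inner s (x - p).
(* Minimality of [p] is tested at [p + t b s]. The optimal [t] is [1 / |s|^2]; the added 1 covers
   [s = 0] and gives [t |s|^2 = 1 - t]. *)
set t := (1 + rnorm s ^+ 2)^-1.
have := dle _ (Slin (t%:C * b) _ _ Ss Sp).
rewrite opprD addrCA -[_ + (x - p)]opprK opprD opprK rnormN.
rewrite rdistrC rnorm_sqrB rnormZ innerZr (inner_conj _ s) -/b.
rewrite -mulrA (mulrC b) mulJc cabsM cabsR !exprMn real_normK ?num_real//.
rewrite ReM_real/= => h.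
have s1 : 0 < 1 + rnorm s ^+ 2 by rewrite ltr_pwDl// sqr_ge0.
have t0 : 0 < t by rewrite invr_gt0.
have ts : t * rnorm s ^+ 2 = 1 - t.
  rewrite /t; apply: (@mulfI _ (1 + rnorm s ^+ 2)); first by rewrite gt_eqF.
  by rewrite mulrBr mulrA divff ?gt_eqF//; ring.
have h' : t * cabs b ^+ 2 * (1 + t) <= 0.
  have E : t ^+ 2 * cabs b ^+ 2 * rnorm s ^+ 2 = t * cabs b ^+ 2 * (1 - t).
    by rewrite -ts; ring.
  rewrite E in h; have := le_trans dp h; lra.
have : cabs b ^+ 2 = 0.
  apply/eqP; rewrite eq_le sqr_ge0 andbT.
  have := h'; rewrite -mulrA pmulr_rle0// pmulr_lle0//; lra.
by move=> /eqP; rewrite sqrf_eq0 => /eqP /rnorm0_eq0.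
Unshelve. all: by end_near. Qed.

(** * Orthonormal families and frame operators *)

Section Orthonormal.
Context (R : realType) (V : hilbertType R) (e : nat -> V).
Hypothesis eE : forall i j, inner (e i) (e j) = (i == j)%:R.

Lemma rnorm_orthonormal i : rnorm (e i) = 1.
Proof.
have := eE i i; rewrite innerxx eqxx => /complexI/eqP.
by rewrite sqrf_eq1 => /orP[/eqP//|/eqP h]; have := rnorm_ge0 (e i); rewrite h ler0N1.
Qed.

Lemma inner_orthonormal_sum (c : nat -> R[i]) i m n :
  inner (e i) (\sum_(m <= j < n) c j *: e j) = if (m <= i < n)%N then c i else 0.
Proof.
rewrite inner_sumr; under eq_bigr do rewrite innerZr eE.
case: ifPn => [/andP[mi ni]|h].
  rewrite (bigD1_seq i) ?mem_index_iota ?mi ?ni ?iota_uniq//= eqxx mulr1.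
  by rewrite big1_seq ?addr0// => j /andP[]; rewrite eq_sym => /negbTE ->; rewrite mulr0.
rewrite big1_seq// => j /andP[_]; rewrite mem_index_iota => mjn.
by case: eqVneq => [ij|]; rewrite ?mulr0//; rewrite ij mjn in h.
Qed.

Lemma rnorm_orthonormal_sum (c : nat -> R[i]) m n :
  rnorm (\sum_(m <= j < n) c j *: e j) ^+ 2 = \sum_(m <= j < n) cabs (c j) ^+ 2.
Proof.
apply: complexI; rewrite -innerxx inner_suml rmorph_sum/=.
apply: eq_big_nat => i mi.
by rewrite innerZl inner_orthonormal_sum mi mulJc.
Qed.

End Orthonormal.

Section FrameOperator.
Context (R : realType).

(** Exchanging the two bases yields a frame whose [frame_op] is the adjoint of that of [F]; see
    [frame_op_adj]. *)
Definition flip_frame (V W : hilbertType R) (F : frame V W) : frame W V :=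
  Frame (kappa_gt0 F) (kappa_nonincr F) (@kappa_l2 _ _ _ F) (psi_basis F) (phi_basis F).

(** Since [|<phi_j, x>| <= |x|], a block of the series has squared norm at most [|x|^2] times the
    same block of the convergent series of the [kappa_j^2]. *)
Lemma frame_series_cvg (V W : hilbertType R) (F : frame V W) x :
  cvgn (series (fun j => ((kappa F j)%:C * inner (phi F j) x) *: psi F j)).
Proof.
apply: hilbert_cauchy => e e0.
pose X := 1 + rnorm x ^+ 2.
have X0 : 0 < X by rewrite ltr_pwDl// sqr_ge0.
have d0 : 0 < e ^+ 2 / X / 2 by rewrite !divr_gt0// exprn_gt0.
have /cvg_ex[L /cvgrPdist_lt/(_ _ d0)[N _ hN]] := @kappa_l2 _ _ _ F.
exists N => m n; wlog mn : m n / (m <= n)%N => [hw Nm Nn|].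
  by case/orP: (leq_total m n) => h; [|rewrite rdistrC]; apply: hw.
move=> Nm Nn; rewrite rdistrC sub_series_geq//.
rewrite -(@ltr_pXn2r _ 2)// ?nnegrE ?rnorm_ge0 ?(ltW e0)//.
rewrite rnorm_orthonormal_sum; last exact: (psi_basis F).1.
have k2 : \sum_(m <= j < n) kappa F j ^+ 2 < e ^+ 2 / X.
  rewrite -(@sub_series_geq R (fun j => kappa F j ^+ 2))//.
  have := hN _ Nm; have := hN _ Nn => /=.
  by rewrite !ltr_norml => /andP[? ?] /andP[? ?]; lra.
apply: le_lt_trans (_ : (\sum_(m <= j < n) kappa F j ^+ 2) * X < _).
  rewrite mulr_suml; apply: ler_sum => j _.
  rewrite cabsM cabsR exprMn real_normK ?num_real// ler_wpM2l ?sqr_ge0//.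
  apply: (@le_trans _ _ (rnorm x ^+ 2)); last by rewrite /X lerDr.
  rewrite lerXn2r ?nnegrE ?rnorm_ge0//.
  have := cauchy_schwarz (phi F j) x.
  by rewrite (rnorm_orthonormal (phi_basis F).1) mul1r.
by rewrite -ltr_pdivlMr.
Qed.

Lemma inner_frame_op (V W : hilbertType R) (F : frame V W) x i :
  inner (psi F i) (frame_op F x) = (kappa F i)%:C * inner (phi F i) x.
Proof.
pose proof (cvg_innerr (y := psi F i) (frame_series_cvg (x := x) (F := F))) as h.
apply: (complex_cvg_unique h).
apply: cvg_near_cst; near=> n.
rewrite (inner_orthonormal_sum (psi_basis F).1
  (fun j => (kappa F j)%:C * inner (phi F j) x)) /=.
by rewrite ifT//; near: n; exact: nbhs_infty_gt.
Unshelve. all: by end_near. Qed.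

Lemma frame_op_adj (V W : hilbertType R) (F : frame V W) x y :
  inner (frame_op F x) y = inner x (frame_op (flip_frame F) y).
Proof.
pose proof (cvg_innerr (y := frame_op F x) ((psi_basis F).2 y)) as h.
pose proof (cvg_innerr (y := x)
  (frame_series_cvg (x := y) (F := flip_frame F))) as h'.
apply: (complex_cvg_unique h).
apply: cvg_trans h'; apply: near_eq_cvg; near=> n.
rewrite /series/= !inner_sumr; apply: eq_bigr => j _.
rewrite !innerZr (inner_conj (frame_op F x)) inner_frame_op conjcM.
by rewrite -inner_conj conjc_real mulrCA mulrA.
Unshelve. all: by end_near. Qed.

(** An adjoint is unique where it exists, so the choice made by [xget] can only be [S]. *)
Lemma adjointE (V W : hilbertType R) (T : V -> W) (S : W -> V) :
  (forall x y, inner (T x) y = inner x (S y)) -> adjoint T = S.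
Proof.
move=> hS; rewrite /adjoint; case: xgetP => [S' _ hS'|/(_ S)]; last by [].
by apply/funext => y; apply: inner_inj => x; rewrite -hS hS'.
Qed.

Lemma adjoint_frame_op (V W : hilbertType R) (F : frame V W) j :
  adjoint (frame_op F) (psi F j) = (kappa F j)%:C *: phi F j.
Proof.
rewrite (adjointE (frame_op_adj F)); apply: inner_inj => x.
rewrite -frame_op_adj inner_conj inner_frame_op conjcM -inner_conj.
by rewrite conjc_real innerZr.
Qed.

(** The factor [kappa F j] stays inside [T], an arbitrary map here: linearity of [resolvent] is
    available at non-real points only. *)
Lemma sandwich_entry (V W : hilbertType R) (F : frame V W) (T : V -> V) i j :
  inner (psi F i) (sandwich F T (psi F j)) =
  (kappa F i)%:C * inner (phi F i) (T ((kappa F j)%:C *: phi F j)).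
Proof. by rewrite /sandwich/= inner_frame_op adjoint_frame_op. Qed.

End FrameOperator.

(** * Resolvents of self-adjoint operators *)

Section Resolvent.
Context (R : realType) (V : hilbertType R) (A : operator V).
Hypothesis hA : self_adjoint A.
Implicit Types (x y f g : V) (z w a : R[i]).

Lemma op_domB x y : op_dom A x -> op_dom A y -> op_dom A (x - y).
Proof. by move=> dx dy; rewrite addrC -scaleN1r; exact: op_domP. Qed.

Lemma op_funB x y : op_dom A x -> op_dom A y -> A (x - y) = A x - A y.
Proof.
by move=> dx dy; rewrite addrC -scaleN1r op_linear// scaleN1r addrC.
Qed.

Lemma op_sym x y : op_dom A x -> op_dom A y -> inner (A x) y = inner x (A y).
Proof. by move=> dx dy; apply: (hA.2 y (A y)).2. Qed.

(** Passing to the limit in [<A v, u n> = <v, A (u n)>] puts [(x, x')] in the graph of [A^*], which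
    is the graph of [A]. *)
Lemma op_closed (u : nat -> V) x (x' : V) : (forall n, op_dom A (u n)) ->
  u @ \oo --> x -> (A (u n)) @[n --> \oo] --> x' -> op_dom A x /\ A x = x'.
Proof.
move=> du ux uw; apply/(hA.2 x x') => v dv.
pose proof (cvg_innerr (y := A v) ux) as h1.
pose proof (cvg_innerr (y := v) uw) as h2.
apply: (complex_cvg_unique h1); move: h2.
by under eq_cvg do rewrite -op_sym//.
Qed.

(** Symmetry makes [<x, A x>] real, so [<x, (A - z) x>] has imaginary part [- Im z |x|^2], and
    Cauchy-Schwarz bounds it by [|x| |(A - z) x|]. *)
Lemma shifted_lower_bound z x : op_dom A x ->
  `|complex.Im z| * rnorm x <= rnorm (A x - z *: x).
Proof.
move=> dx; have [->|x0] := eqVneq x 0; first by rewrite rnorm0 mulr0 rnorm_ge0.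
have nx : 0 < rnorm x.
  by rewrite lt_def rnorm_ge0 andbT; apply: contra_neq x0; exact: rnorm0_eq0.
have ImA : complex.Im (inner x (A x)) = 0.
  have := op_sym dx dx; rewrite inner_conj => /(congr1 (@complex.Im R)).
  by rewrite ImJ => h; lra.
rewrite -(ler_pM2l nx); apply: le_trans (cauchy_schwarz _ _).
apply: le_trans (Im_le_cabs _); rewrite innerBr innerZr innerxx.
rewrite ImD ImN ImA mulrC mulrC (mulrC z) ImM_real sub0r normrN normrM.
by rewrite ger0_norm ?sqr_ge0// expr2 mulrA mulrAC mulrC mulrA.
Qed.

Lemma shiftedB z x y : op_dom A x -> op_dom A y ->
  A (x - y) - z *: (x - y) = (A x - z *: x) - (A y - z *: y).
Proof.
by move=> dx dy; rewrite op_funB// scalerBr !opprD !opprK addrACA.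
Qed.

Lemma shifted_inj z x y : complex.Im z != 0 -> op_dom A x -> op_dom A y ->
  A x - z *: x = A y - z *: y -> x = y.
Proof.
move=> z0 dx dy h; apply/subr0_eq/rnorm0_eq0/eqP.
have := shifted_lower_bound z (op_domB dx dy).
rewrite shiftedB// h subrr rnorm0 pmulr_rle0 ?normr_gt0// => h'.
by rewrite eq_le h' rnorm_ge0.
Qed.

(** The range of [A - z] is closed, by [shifted_lower_bound] and the closedness of [A]. A vector [v]
    orthogonal to it satisfies [A v = conjc z *: v], because [A^* = A], and vanishes by the same
    lower bound. *)
Lemma shifted_surj z x : complex.Im z != 0 ->
  exists y, op_dom A y /\ A y - z *: y = x.
Proof.
move=> z0; pose S := [set A y - z *: y | y in op_dom A].
have S0 : S 0.
  by exists (0 - 0); [exact/op_domB/op_dom0/op_dom0|rewrite op_funB ?subrr ?scaler0 ?subrr//; exact: op_dom0].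
have Slin a u v : S u -> S v -> S (a *: u + v).
  move=> [p dp <-] [q dq <-]; exists (a *: p + q); first exact: op_domP.
  rewrite op_linear// scalerBr scalerDr !scalerA (mulrC z) opprD.
  by rewrite addrACA.
have Scl (u : nat -> V) v : (forall n, S (u n)) -> u @ \oo --> v -> S v.
  move=> /= Su uv.
  have ex n : exists q, op_dom A q /\ A q - z *: q = u n.
    by have [q dq e] := Su n; exists q.
  have [p hp] := choice ex.
  have cp : cvgn p.
    apply: hilbert_cauchy => e e0.
    have c0 : 0 < `|complex.Im z| by rewrite normr_gt0.
    have /cvg_rnormP/cvgrPdist_lt := uv.
    have e1 : 0 < `|complex.Im z| * e / 2 by rewrite divr_gt0// mulr_gt0.
    move=> /(_ _ e1)[N _ hN]; exists N => m n Nm Nn.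
    rewrite -(ltr_pM2l c0).
    apply: le_lt_trans (shifted_lower_bound z (op_domB (hp m).1 (hp n).1)) _.
    have -> : A (p m - p n) - z *: (p m - p n) = u m - u n.
      by rewrite (shiftedB _ (hp m).1 (hp n).1) (hp m).2 (hp n).2.
    have := hN _ Nm; have := hN _ Nn => /=.
    rewrite !sub0r !normrN !(ger0_norm (rnorm_ge0 _)) => h1 h2.
    apply: le_lt_trans (_ : rnorm (u m - v) + rnorm (u n - v) < _); last by lra.
    have -> : u m - u n = (u m - v) - (u n - v) by rewrite opprB addrA subrK.
    exact: ler_rnormB.
  have [|||dq qE] := @op_closed p (limn p) (v + z *: limn p).
  - by move=> n; exact: (hp n).1.
  - exact: cp.
  - have -> : (fun n => A (p n)) = (fun n => u n + z *: p n).
      by apply/funext => n; rewrite -(hp n).2 subrK.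
    apply: cvgD => //; apply: cvgZl_tmp; exact: cp.
  by exists (limn p) => //; rewrite qE addrK.
have [p [y dy py] orth] := orthogonal_projection S0 Slin Scl x.
exists y; split => //; rewrite py; apply/esym/subr0_eq.
set v := x - p in orth *.
have [dv vE] : op_dom A v /\ A v = conjc z *: v.
  apply/(hA.2 v) => u du.
  have := orth (A u - z *: u); rewrite innerBl innerZl => /(_ _)/subr0_eq ->.
    by rewrite innerZr.
  by exists u.
have := shifted_lower_bound (conjc z) dv; rewrite vE subrr rnorm0 ImJ normrN.
rewrite pmulr_rle0 ?normr_gt0// => h; apply: rnorm0_eq0.
by apply/eqP; rewrite eq_le h rnorm_ge0.
Qed.

Lemma resolventP z x : complex.Im z != 0 ->
  op_dom A (resolvent A z x) /\
  A (resolvent A z x) - z *: resolvent A z x = x.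
Proof.
move=> z0; rewrite /resolvent; case: xgetP => [y _ //|h].
by have [y hy] := shifted_surj x z0; case: (h y).
Qed.

Lemma resolventE z x : complex.Im z != 0 -> op_dom A x ->
  resolvent A z (A x - z *: x) = x.
Proof.
move=> z0 dx; have [dy yE] := resolventP (A x - z *: x) z0.
exact: shifted_inj yE.
Qed.

Lemma resolvent_linear z a x y : complex.Im z != 0 ->
  resolvent A z (a *: x + y) = a *: resolvent A z x + resolvent A z y.
Proof.
move=> z0; have [dx {1}<-] := resolventP x z0; have [dy {1}<-] := resolventP y z0.
rewrite -[RHS](resolventE z0 (op_domP a dx dy)) op_linear//; congr resolvent.
by rewrite scalerBr scalerDr !scalerA (mulrC z) opprD addrACA.
Qed.

Lemma resolventZ z a x : complex.Im z != 0 ->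
  resolvent A z (a *: x) = a *: resolvent A z x.
Proof.
move=> z0; have r0 : resolvent A z 0 = 0.
  have := resolvent_linear (-1) 0 0 z0.
  by rewrite scaler0 addr0 scaleN1r addNr.
by have := resolvent_linear a x 0 z0; rewrite r0 !addr0.
Qed.

Lemma resolventB z x y : complex.Im z != 0 ->
  resolvent A z (x - y) = resolvent A z x - resolvent A z y.
Proof.
move=> z0; have := resolvent_linear (-1) y x z0.
by rewrite !scaleN1r addrC => ->; rewrite addrC.
Qed.

Lemma resolvent_bound z x : complex.Im z != 0 ->
  `|complex.Im z| * rnorm (resolvent A z x) <= rnorm x.
Proof.
move=> z0; have [dy {2}<-] := resolventP x z0; exact: shifted_lower_bound.
Qed.

Lemma resolvent_adj z x y : complex.Im z != 0 ->
  inner (resolvent A z x) y = inner x (resolvent A (conjc z) y).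
Proof.
move=> z0; have z0' : complex.Im (conjc z) != 0 by rewrite ImJ oppr_eq0.
have [dx {2}<-] := resolventP x z0; have [dy {1}<-] := resolventP y z0'.
by rewrite innerBr innerBl innerZl innerZr op_sym.
Qed.

Lemma resolvent_identity z w x : complex.Im z != 0 -> complex.Im w != 0 ->
  resolvent A z x - resolvent A w x =
  (z - w) *: resolvent A z (resolvent A w x).
Proof.
move=> z0 w0; have [dx xE] := resolventP x w0.
set p := resolvent A w x in dx xE *.
have -> : x = (z - w) *: p + (A p - z *: p).
  by rewrite -[LHS]xE scalerBl [RHS]addrC addrA subrK.
by rewrite resolvent_linear// resolventE// addrK.
Qed.

Lemma resolventC z w x : complex.Im z != 0 -> complex.Im w != 0 ->
  resolvent A z (resolvent A w x) = resolvent A w (resolvent A z x).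
Proof.
move=> z0 w0; have [->//|zw] := eqVneq z w.
have h1 := resolvent_identity x z0 w0; have h2 := resolvent_identity x w0 z0.
apply: (@scalerI _ _ (z - w)); first by rewrite subr_eq0.
by rewrite -h1 -opprB h2 -scaleNr opprB.
Qed.

End Resolvent.

(* The increments of [4 x / (1 + |x|)] dominate [1 / (1 + x^2)] at the integers. *)
Lemma sum_inv_sqr_le (R : realType) (k m : nat) :
  \sum_(0 <= l < m) (1 + (l%:R - k%:R) ^+ 2)^-1 <= 8 :> R.
Proof.
pose g (x : R) := 4 * x / (1 + `|x|).
have den (x : R) : 0 < 1 + `|x| by rewrite ltr_pwDl.
have g4 x : `|g x| <= 4.
  rewrite /g normrM normfV normrM (gtr0_norm (den x)) ler_pdivrMr//.
  by rewrite ger0_norm//; lra.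
have sq (x : R) : 0 < 1 + x ^+ 2 by rewrite ltr_pwDl// sqr_ge0.
have pos x : 0 <= x -> (1 + x ^+ 2)^-1 <= g (x + 1) - g x.
  move=> x0; rewrite /g (ger0_norm x0) ger0_norm ?addr_ge0//.
  have -> : 4 * (x + 1) / (1 + (x + 1)) - 4 * x / (1 + x) =
      4 / ((1 + (x + 1)) * (1 + x)) by field; rewrite !gt_eqF//; lra.
  rewrite -[leLHS]div1r ler_pdivrMr ?sq// mulrAC ler_pdivlMr; last by nra.
  by have := sqr_ge0 (x - 1); nra.
have neg x : x <= -1 -> (1 + x ^+ 2)^-1 <= g (x + 1) - g x.
  move=> x1; have x0 : x <= 0 by lra.
  have x10 : x + 1 <= 0 by lra.
  rewrite /g (ler0_norm x0) (ler0_norm x10).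
  have -> : 4 * (x + 1) / (1 - (x + 1)) - 4 * x / (1 - x) =
      4 / ((- x) * (1 - x)) by
    field; apply/and3P; split; [apply: lt0r_neq0|apply: ltr0_neq0|apply: lt0r_neq0];
    lra.
  rewrite -[leLHS]div1r ler_pdivrMr ?sq// mulrAC ler_pdivlMr; last by nra.
  by have := sqr_ge0 (x + 1); nra.
have step (l : nat) : (1 + (l%:R - k%:R) ^+ 2)^-1 <=
    g (l.+1%:R - k%:R) - g (l%:R - k%:R) :> R.
  have -> : l.+1%:R - k%:R = l%:R - k%:R + 1 :> R by rewrite -natr1; ring.
  (* [l - k] is an integer, so [x] and [x + 1] lie on the same side of 0, where [g] is a single
     rational function. *)
  have [kl|lk] := leqP k l; first by apply: pos; rewrite subr_ge0 ler_nat.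
  by apply: neg; rewrite lerBlDr addrC -(ltn_predK lk) -natr1 addrK ler_nat
    -ltnS (ltn_predK lk).
apply: le_trans (ler_sum_nat (fun l _ => step l)) _.
rewrite telescope_sumr//.
have := g4 (m%:R - k%:R); have := g4 (0%:R - k%:R).
by rewrite !ler_norml => /andP[? ?] /andP[? ?]; lra.
Qed.

(** * Smoothed spectral densities *)

Section PoissonForm.
Context (R : realType) (V : hilbertType R) (A : operator V).
Hypothesis hA : self_adjoint A.
Implicit Types (f g h x v : V) (l y : R).

Definition poisson_form l y f g : R[i] :=
  inner f (im_op (resolvent A (l +i* y)) g).

(** The adjoint of [R_z] is the resolvent at [conjc z], and the resolvent identity for these two
    points, with [z - conjc z = 2 i y], factors the difference. *)
Lemma im_op_resolvent l y x : y != 0 ->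
  im_op (resolvent A (l +i* y)) x =
  y%:C *: resolvent A (l -i* y) (resolvent A (l +i* y) x).
Proof.
move=> y0; have y0' : - y != 0 by rewrite oppr_eq0.
rewrite /im_op (adjointE (fun u v => resolvent_adj hA (z := l +i* y) u v y0)).
rewrite (resolvent_identity hA (z := l +i* y) (w := l -i* y) _ y0 y0')/= scalerA (resolventC hA)//.
congr (_ *: _); apply/eqP; rewrite eq_complex/=.
by apply/andP; split; apply/eqP; field.
Qed.

Lemma poisson_formE l y f g : y != 0 ->
  poisson_form l y f g = y%:C *
    inner (resolvent A (l +i* y) f) (resolvent A (l +i* y) g).
Proof.
by move=> y0; rewrite /poisson_form im_op_resolvent// innerZr (resolvent_adj hA).
Qed.

Lemma poisson_formxx l y f : y != 0 ->
  poisson_form l y f f = (y * rnorm (resolvent A (l +i* y) f) ^+ 2)%:C.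
Proof. by move=> y0; rewrite poisson_formE// innerxx real_complexM. Qed.

(* [dresolvent_adj l y \o dresolvent l y] is the inverse of
   ((A - l)^2 + y^2) ((A - l)^2 + 4 y^2). *)
Definition dresolvent l y x : V :=
  resolvent A (l +i* y) (resolvent A (l +i* (2 * y)) x).

Definition dresolvent_adj l y x : V :=
  resolvent A (l -i* (2 * y)) (resolvent A (l -i* y) x).

Definition smooth_form l y f g : R[i] :=
  poisson_form l y f g - 2^-1 * poisson_form l (2 * y) f g.

(* Decay of fourth order at infinity, instead of second order for the Poisson
   kernel, is what makes the almost orthogonality estimate below summable. *)
Lemma smooth_formE l y f g : 0 < y ->
  smooth_form l y f g =
  (3 * y ^+ 3)%:C * inner (dresolvent l y f) (dresolvent l y g).
Proof.
move=> y_gt0; have y0 : y != 0 by rewrite gt_eqF.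
have y20 : 2 * y != 0 by rewrite mulf_neq0// pnatr_eq0.
have Ny0 : - y != 0 by rewrite oppr_eq0.
have Ny20 : - (2 * y) != 0 by rewrite oppr_eq0.
rewrite /smooth_form /poisson_form !im_op_resolvent// /dresolvent.
set z := l +i* y; set zc := l -i* y; set w := l +i* (2 * y).
set wc := l -i* (2 * y).
have -> : inner (resolvent A z (resolvent A w f))
    (resolvent A z (resolvent A w g)) = inner f
    (resolvent A wc (resolvent A zc (resolvent A w (resolvent A z g)))).
  by rewrite !(resolvent_adj hA)//= (resolventC hA (z := z)).
(* Partial fractions [1 / ((t^2 + y^2) (t^2 + 4 y^2)) = (1 / (t^2 + y^2) - 1 / (t^2 + 4 y^2)) / (3
   y^2)] at [t = A - l]. [E1] and [E2] change one resolvent at a time; together they give the factor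
   [(i y) (- 3 i y) = 3 y^2]. *)
have -> : resolvent A wc (resolvent A zc (resolvent A w (resolvent A z g))) =
    ((3 * y ^+ 2)^-1)%:C *: (resolvent A zc (resolvent A z g) -
                      resolvent A wc (resolvent A w g)).
  have E1 : resolvent A zc (resolvent A z g) - resolvent A wc (resolvent A z g)
      = (0 +i* y) *: resolvent A wc (resolvent A zc (resolvent A z g)).
    rewrite (resolvent_identity hA)// (resolventC hA)//; congr (_ *: _).
    by apply/eqP; rewrite eq_complex/=; apply/andP; split; apply/eqP; ring.
  have E2 : resolvent A wc (resolvent A z g) - resolvent A wc (resolvent A w g)
      = - (0 +i* y) *: resolvent A wc (resolvent A w (resolvent A z g)).
    rewrite -(resolventB hA)// (resolvent_identity hA)// (resolventZ hA)//.
    rewrite (resolventC hA (z := z))//; congr (_ *: _).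
    by apply/eqP; rewrite eq_complex/=; apply/andP; split; apply/eqP; ring.
  have -> : resolvent A zc (resolvent A z g) - resolvent A wc (resolvent A w g)
      = (resolvent A zc (resolvent A z g) - resolvent A wc (resolvent A z g))
      + (resolvent A wc (resolvent A z g) - resolvent A wc (resolvent A w g)).
    by rewrite addrA subrK.
  rewrite E1 E2 scaleNr -scalerBr -(resolventB hA)//.
  rewrite (resolvent_identity hA)// (resolventZ hA)// !scalerA.
  rewrite -[LHS]scale1r; congr (_ *: _).
  by apply/eqP; rewrite eq_complex/=; apply/andP; split; apply/eqP; field.
rewrite !innerZr innerBr mulrA.
have -> : (3 * y ^+ 3)%:C * ((3 * y ^+ 2)^-1)%:C = y%:C :> R[i].
  by rewrite -real_complexM; congr (_%:C); field.
rewrite mulrBr; congr (_ - _); rewrite mulrA; congr (_ * _).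
by apply/eqP; rewrite eq_complex/=; apply/andP; split; apply/eqP; field.
Qed.

Lemma smooth_formxx l y f : 0 < y ->
  smooth_form l y f f = (3 * y ^+ 3 * rnorm (dresolvent l y f) ^+ 2)%:C.
Proof. by move=> y0; rewrite smooth_formE// innerxx -real_complexM. Qed.

Lemma smooth_form_cauchy_schwarz l y f g : 0 < y ->
  cabs (smooth_form l y f g) ^+ 2 <=
  complex.Re (smooth_form l y f f) * complex.Re (smooth_form l y g g).
Proof.
move=> y0; rewrite !smooth_formxx//= smooth_formE// cabsM cabsR exprMn.
have c0 : 0 <= 3 * y ^+ 3 by rewrite mulr_ge0// exprn_ge0// ltW.
rewrite (ger0_norm c0) [leRHS]mulrACA -(expr2 (3 * y ^+ 3)); apply: ler_wpM2l.
  exact: sqr_ge0.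
by rewrite -exprMn lerXn2r ?nnegrE ?mulr_ge0 ?rnorm_ge0// cauchy_schwarz.
Qed.

(** [R_{l+iy} = (1 + (l - l') R_{l+iy}) R_{l'+iy}], and the first factor has norm at most 2 because
    [|R_{l+iy}| <= 1 / y]. As with Harnack's inequality, one point then represents a whole cell of
    length [y]. *)
Lemma resolvent_harnack l l' y x : 0 < y -> `|l - l'| <= y ->
  rnorm (resolvent A (l +i* y) x) <= 2 * rnorm (resolvent A (l' +i* y) x).
Proof.
move=> y_gt0 ll'; have y0 : y != 0 by rewrite gt_eqF.
have /= := resolvent_identity hA (z := l +i* y) (w := l' +i* y) x y0 y0.
move=> /(canRL (subrK _)) ->.
have -> : l +i* y - (l' +i* y) = (l - l')%:C.
  by apply/eqP; rewrite eq_complex/= subrr !eqxx.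
apply: le_trans (ler_rnormD _ _) _; rewrite rnormZ cabsR.
set u := resolvent A (l' +i* y) x.
have := resolvent_bound hA (z := l +i* y) u y0.
rewrite /= (gtr0_norm y_gt0) => h.
have := ler_wpM2r (rnorm_ge0 (resolvent A (l +i* y) u)) ll'; lra.
Qed.

Lemma dresolvent_harnack l l' y x : 0 < y -> `|l - l'| <= y ->
  rnorm (dresolvent l y x) <= 4 * rnorm (dresolvent l' y x).
Proof.
move=> y_gt0 ll'; have y0 : y != 0 by rewrite gt_eqF.
have y2_gt0 : 0 < 2 * y by rewrite mulr_gt0.
have y20 : 2 * y != 0 by rewrite gt_eqF.
apply: le_trans (resolvent_harnack _ y_gt0 ll') _.
rewrite (resolventC hA)//.
have ll2 : `|l - l'| <= 2 * y by lra.
have := resolvent_harnack (resolvent A (l' +i* y) x) y2_gt0 ll2.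
by rewrite [X in _ <= 2 * rnorm X](resolventC hA)// -/(dresolvent _ _ _); lra.
Qed.

(** The resolvent identity turns the product, multiplied by the difference of the two spectral
    parameters, into a difference of two resolvents, each of norm at most [1 / y]. *)
Lemma resolvent_almost_orthogonal l l' y x : 0 < y ->
  cabs ((l - l') +i* (2 * y)) *
    rnorm (resolvent A (l +i* y) (resolvent A (l' -i* y) x)) <=
  2 / y * rnorm x.
Proof.
move=> y_gt0; have y0 : y != 0 by rewrite gt_eqF.
have Ny0 : - y != 0 by rewrite oppr_eq0.
have -> : (l - l') +i* (2 * y) = (l +i* y) - (l' -i* y).
  by apply/eqP; rewrite eq_complex/=; apply/andP; split; apply/eqP; ring.
rewrite -rnormZ -(resolvent_identity hA)//.
apply: le_trans (ler_rnormB _ _) _.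
have := resolvent_bound hA (z := l +i* y) x y0.
have := resolvent_bound hA (z := l' -i* y) x Ny0.
rewrite /= normrN (gtr0_norm y_gt0) mulrAC ler_pdivlMr// => h1 h2.
by rewrite mulrDl ![_ * y]mulrC; lra.
Qed.

(** The four resolvents commute and are regrouped into a pair at scale [y] and a pair at scale
    [2 y]. Each pair contributes one factor of decay in [l - l'], and the one at scale [2 y] is the
    stronger ([c <= d]). *)
Lemma dresolvent_almost_orthogonal l l' y x : 0 < y ->
  ((l - l') ^+ 2 + 4 * y ^+ 2) *
    rnorm (dresolvent l y (dresolvent_adj l' y x)) <=
  2 / y ^+ 2 * rnorm x.
Proof.
move=> y_gt0; have y0 : y != 0 by rewrite gt_eqF.
have y2_gt0 : 0 < 2 * y by rewrite mulr_gt0.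
have y20 : 2 * y != 0 by rewrite gt_eqF.
have Ny0 : - y != 0 by rewrite oppr_eq0.
have Ny20 : - (2 * y) != 0 by rewrite oppr_eq0.
rewrite /dresolvent /dresolvent_adj.
rewrite (resolventC hA (z := l' -i* (2 * y)))//.
rewrite (resolventC hA (z := l +i* (2 * y)) (w := l' -i* y))//.
set u := resolvent A (l +i* (2 * y)) (resolvent A (l' -i* (2 * y)) x).
have h1 := resolvent_almost_orthogonal l l' u y_gt0.
have h2 := resolvent_almost_orthogonal l l' x y2_gt0; rewrite -/u in h2.
set c := cabs (_ +i* _) in h1; set d := cabs (_ +i* _) in h2.
set r := rnorm (resolvent _ _ _) in h1 *.
have c2 : c ^+ 2 = (l - l') ^+ 2 + 4 * y ^+ 2 by rewrite /c cabs_sqr/=; ring.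
have cd : c <= d.
  rewrite -(@ler_pXn2r _ 2)// ?nnegrE ?rnorm_ge0//.
  by rewrite c2 /d cabs_sqr/= lerD2l; nra.
rewrite -c2 expr2 -mulrA.
apply: le_trans (ler_wpM2l (rnorm_ge0 _) h1) _.
rewrite mulrCA.
have -> : 2 / y ^+ 2 * rnorm x = 2 / y * (2 / (2 * y) * rnorm x) by field.
apply: ler_wpM2l; first by rewrite divr_ge0// ltW.
by apply: le_trans h2; apply: ler_wpM2r cd; exact: rnorm_ge0.
Qed.

Lemma dresolvent_adjP l y x v : y != 0 ->
  inner (dresolvent_adj l y x) v = inner x (dresolvent l y v).
Proof.
move=> y0; have y20 : 2 * y != 0 by rewrite mulf_neq0// pnatr_eq0.
by rewrite /dresolvent_adj !(resolvent_adj hA) ?oppr_eq0//= !opprK.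
Qed.

(** With [T_k = y^2 dresolvent (p k) y], the sum is [S = <v, h>] for [v = sum_k T_k^* T_k h]. Here
    [|v|^2] is the double sum of [<T_k h, T_k T_l^* T_l h>], which the decay of [T_k T_l^*] bounds
    by [16 S]; then [S^2 <= |v|^2 |h|^2 <= 16 S |h|^2]. *)
Lemma dresolvent_schur a y h m : 0 < y ->
  \sum_(0 <= k < m) y ^+ 4 * rnorm (dresolvent (a + k%:R * y) y h) ^+ 2 <=
  16 * rnorm h ^+ 2.
Proof.
move=> y_gt0; have y0 : y != 0 by rewrite gt_eqF.
pose p k := a + k%:R * y.
pose t k := y ^+ 2 * rnorm (dresolvent (p k) y h).
(* A bound for the norm of [T_k T_l^*]: the points [p k] are [y] apart, and the 4 of
   [dresolvent_almost_orthogonal] is weakened to 1 to match [sum_inv_sqr_le]. *)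
pose M (k l : nat) : R := 2 * (1 + (l%:R - k%:R) ^+ 2)^-1.
set S := \sum_(0 <= k < m) _.
have SE : S = \sum_(0 <= k < m) t k ^+ 2.
  by apply: eq_bigr => k _; rewrite /t exprMn -exprM.
have t0 k : 0 <= t k by rewrite mulr_ge0 ?sqr_ge0 ?rnorm_ge0.
have S0 : 0 <= S by rewrite SE sumr_ge0// => k _; exact: sqr_ge0.
pose v := \sum_(0 <= k < m)
  (y ^+ 4)%:C *: dresolvent_adj (p k) y (dresolvent (p k) y h).
have hv : inner v h = S%:C.
  rewrite inner_suml /S rmorph_sum/=; apply: eq_bigr => k _.
  rewrite innerZl conjc_real dresolvent_adjP// innerxx.
  exact/esym/real_complexM.
have vv : rnorm v ^+ 2 <= 16 * S.
  have -> : rnorm v ^+ 2 = complex.Re (inner v v) by rewrite innerxx.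
  apply: le_trans (_ : \sum_(0 <= k < m) \sum_(0 <= l < m)
      (t k ^+ 2 + t l ^+ 2) / 2 * M k l <= _).
    rewrite {1}/v inner_suml Re_sum; apply: ler_sum => k _.
    rewrite inner_sumr Re_sum; apply: ler_sum => l _.
    rewrite innerZl innerZr conjc_real !ReM_real dresolvent_adjP//.
    apply: (@le_trans _ _ (t k * t l * M k l)); last first.
      apply: ler_wpM2r; last by have := sqr_ge0 (t k - t l); lra.
      by rewrite mulr_ge0// invr_ge0 addr_ge0// sqr_ge0.
    set b := dresolvent (p k) y h; set c := dresolvent (p l) y h.
    have h1 := dresolvent_almost_orthogonal (p k) (p l) c y_gt0.
    set d := dresolvent (p k) y _ in h1 *.
    have h2 : complex.Re (inner b d) <= rnorm b * rnorm d.
      apply: le_trans (ler_norm _) _.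
      exact: le_trans (Re_le_cabs _) (cauchy_schwarz _ _).
    have h3 : (1 + (l%:R - k%:R) ^+ 2) * y ^+ 4 * rnorm d <= 2 * rnorm c.
      have -> : 2 * rnorm c = y ^+ 2 * (2 / y ^+ 2 * rnorm c) by field.
      apply: le_trans (ler_wpM2l (sqr_ge0 _) h1).
      rewrite [leRHS]mulrA; apply: ler_wpM2r; first exact: rnorm_ge0.
      have -> : p k - p l = (k%:R - l%:R) * y by rewrite /p; ring.
      have -> : y ^+ 2 * (((k%:R - l%:R) * y) ^+ 2 + 4 * y ^+ 2) =
        (4 + (l%:R - k%:R) ^+ 2) * y ^+ 4 by ring.
      by apply: ler_wpM2r; [rewrite exprn_ge0// ltW|lra].
    set q := 1 + _ in h3 *; have q0 : 0 < q by rewrite ltr_pwDl// sqr_ge0.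
    have h4 : y ^+ 4 * rnorm d <= 2 * rnorm c * q^-1.
      by rewrite ler_pdivlMr// mulrC mulrA.
    have y4 : 0 <= y ^+ 4 by rewrite exprn_ge0// ltW.
    apply: le_trans (ler_wpM2l y4 (ler_wpM2l y4 h2)) _.
    have -> : t k * t l * M k l = y ^+ 4 * rnorm b * (2 * rnorm c * q^-1).
      by rewrite /t /M -/b -/c -/q; ring.
    have -> : y ^+ 4 * (y ^+ 4 * (rnorm b * rnorm d)) =
      y ^+ 4 * rnorm b * (y ^+ 4 * rnorm d) by ring.
    by apply: ler_wpM2l h4; rewrite mulr_ge0 ?rnorm_ge0.
  (* Schur's test: [t k * t l] has been split into two half squares, and the row sums of [M] are at
     most 2 * 8. The other half follows from the symmetry of [M]. *)
  have E : \sum_(0 <= k < m) \sum_(0 <= l < m) t k ^+ 2 / 2 * M k l <= 8 * S.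
    rewrite SE mulr_sumr; apply: ler_sum => k _.
    rewrite -mulr_sumr /M -mulr_sumr mulrA divfK ?pnatr_eq0// mulrC.
    by apply: ler_wpM2r (sum_inv_sqr_le _ _ _); exact: sqr_ge0.
  have E' : \sum_(0 <= k < m) \sum_(0 <= l < m) t l ^+ 2 / 2 * M k l <= 8 * S.
    apply: le_trans E; rewrite exchange_big/= le_eqVlt; apply/orP; left.
    apply/eqP; apply: eq_bigr => k _; apply: eq_bigr => l _.
    by congr (_ * (2 / (1 + _))); rewrite -sqrrN opprB.
  apply: le_trans (_ : \sum_(0 <= k < m) \sum_(0 <= l < m) t k ^+ 2 / 2 * M k l
    + \sum_(0 <= k < m) \sum_(0 <= l < m) t l ^+ 2 / 2 * M k l <= _); last lra.
  rewrite -big_split/=; apply: ler_sum => k _; rewrite -big_split/=.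
  by apply: ler_sum => l _; rewrite -[leRHS]mulrDl -[in leRHS]mulrDl.
have Sle : S <= rnorm v * rnorm h.
  apply: le_trans (cauchy_schwarz _ _); rewrite hv cabsR; exact: ler_norm.
have : S ^+ 2 <= S * (16 * rnorm h ^+ 2).
  apply: (@le_trans _ _ ((rnorm v * rnorm h) ^+ 2)).
    by rewrite lerXn2r ?nnegrE ?mulr_ge0 ?rnorm_ge0.
  rewrite exprMn (mulrCA S) (mulrC 16) mulrA -mulrA.
  have := ler_wpM2r (sqr_ge0 (rnorm h)) vv; lra.
have [->|Sn] := eqVneq S 0; first by rewrite mulr_ge0 ?sqr_ge0.
by rewrite expr2 ler_pM2l// lt_def Sn.
Qed.

End PoissonForm.

(** [[-N, N)] is cut into [2 N (n + 1)] cells of length [1 / (n + 1)], and [s n] is a step function,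
    measurable by construction. Its value on a cell is the density at the left end times 4^2, by
    [dresolvent_harnack]. This gives the constant 48 = 3 * 16, and its integral is 48 times the sum
    in [dresolvent_schur]. *)
Lemma smooth_form_majorant (R : realType) (V : hilbertType R) (A : operator V)
    (hA : self_adjoint A) (N : nat) (h : V) :
  exists s : nat -> measurableTypeR R -> R,
  [/\ forall n, measurable_fun setT (s n), forall n l, 0 <= s n l,
      forall n (l : R), - N%:R <= l < N%:R ->
        complex.Re (smooth_form A l n.+1%:R^-1 h h) <= s n l
    & forall n, (\int[lebesgue_measure]_l (s n l)%:E <=
                 (768 * rnorm h ^+ 2)%:E)%E].
Proof.
pose y n : R := n.+1%:R^-1.
have y0 n : 0 < y n by rewrite invr_gt0.
pose p n (k : nat) : R := - N%:R + k%:R * y n.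
pose I n k : set R := [set` `[p n k, p n k + y n[ ].
pose c n k := 48 * y n ^+ 3 * rnorm (dresolvent A (p n k) (y n) h) ^+ 2.
have c0 n k : 0 <= c n k.
  by rewrite mulr_ge0 ?sqr_ge0// mulr_ge0// exprn_ge0// ltW.
pose s n (l : measurableTypeR R) : R :=
  \sum_(0 <= k < (2 * N * n.+1)) c n k * \1_(I n k) l.
have mI n k : measurable (I n k : set (measurableTypeR R)) by exact: measurable_itv.
have mt n k : measurable_fun setT
    (fun l : measurableTypeR R => c n k * \1_(I n k) l).
  apply: measurable_funM; first exact: measurable_cst.
  exact: measurable_indic.
have t0 n k l : 0 <= c n k * \1_(I n k) l by rewrite mulr_ge0// indicE.
exists s; split.
- by move=> n; apply: measurable_sum.
- by move=> n l; apply: sumr_ge0.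
- move=> n l /andP[Nl lN].
  have lN0 : 0 <= l + N%:R by rewrite -lerBlDr sub0r.
  set k := Num.truncn ((l + N%:R) * n.+1%:R).
  have /andP[k1 k2] : k%:R <= (l + N%:R) * n.+1%:R < k.+1%:R.
    by apply: truncn_itv; rewrite mulr_ge0.
  have km : (k < 2 * N * n.+1)%N.
    rewrite -(ltr_nat R); apply: le_lt_trans k1 _.
    by rewrite natrM ltr_pM2r// natrM; lra.
  have pl : p n k <= l.
    by rewrite /p addrC lerBlDr -ler_pdivlMr ?y0// /y invrK.
  have lp : l < p n k + y n.
    have : l + N%:R < k.+1%:R * y n by rewrite -ltr_pdivrMr ?y0// /y invrK.
    by rewrite -natr1 /p; lra.
  apply: (@le_trans _ _ (c n k * \1_(I n k) l)).
    rewrite indicE mem_set/=; last by rewrite /I/= in_itv/= pl lp.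
    rewrite mulr1 smooth_formxx//=.
    have dl : `|l - p n k| <= y n.
      by rewrite ger0_norm ?subr_ge0// lerBlDl ltW.
    have := dresolvent_harnack hA h (y0 n) dl.
    rewrite -(@ler_pXn2r _ 2)// ?nnegrE ?mulr_ge0 ?rnorm_ge0// exprMn => h1.
    have y3 : 0 <= 3 * y n ^+ 3 by rewrite mulr_ge0// exprn_ge0// ltW.
    apply: le_trans (ler_wpM2l y3 h1) _.
    by rewrite /c le_eqVlt; apply/orP; left; apply/eqP; ring.
  rewrite /s (bigD1_seq k) ?mem_index_iota ?iota_uniq//= lerDl.
  by apply: sumr_ge0.
- move=> n.
  under eq_integral do rewrite /s -sumEFin.
  rewrite ge0_integral_sum//; last 2 first.
  - by move=> k; apply/measurable_EFinP.
  - by move=> k l _; rewrite lee_fin.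
  apply: (@le_trans _ _ (\sum_(0 <= k < 2 * N * n.+1) (c n k * y n)%:E)%E).
    (* [ck] is the side condition of [integralZl_indic], vacuous because [c n k] is nonnegative. *)
    apply: lee_sum => k _; have ck : c n k < 0 -> I n k = set0.
      by move=> ck; have := c0 n k; rewrite leNgt ck.
    rewrite (@integralZl_indic _ _ _ lebesgue_measure _ measurableT
      (fun=> I n k) _ ck (mI n k)).
    rewrite integral_indic// setIT.
    have /= := @lebesgue_measure_itv R `[p n k, p n k + y n[.
    have py : p n k + y n - p n k = y n by rewrite addrC addKr.
    rewrite lte_fin ltrDl y0 -EFinD py => Iy.
    by rewrite (EFinM (c n k) (y n)) -Iy.
  rewrite sumEFin lee_fin.
  have := dresolvent_schur hA (- N%:R) h (2 * N * n.+1) (y0 n).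
  set S := \sum_(0 <= k < _) _ => hS.
  have -> : \sum_(0 <= k < 2 * N * n.+1) c n k * y n = 48 * S.
    by rewrite /S mulr_sumr; apply: eq_bigr => k _; rewrite /c /p; ring.
  by lra.
Qed.

(** * Lower limits and integrals without measurability *)

Lemma le_limn_einf (R : realType) (u v : (\bar R)^nat) :
  (\forall n \near \oo, (u n <= v n)%E) -> (limn_einf u <= limn_einf v)%E.
Proof.
move=> [N _ uv]; rewrite !limn_einf_lim; apply: lee_lim.
- exact: is_cvg_einfs.
- exact: is_cvg_einfs.
near=> n; apply: le_ereal_inf_tmp => _ [k /= nk <-].
apply: le_trans (uv k _); last first.
  by apply: leq_trans nk; near: n; exact: nbhs_infty_ge.
by apply: ereal_inf_lbound; exists k.
Unshelve. all: by end_near. Qed.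

Lemma limn_einf_cst (R : realType) (c : \bar R) : limn_einf (fun=> c) = c.
Proof. exact: (cvg_limn_einf_sup (cvg_cst c)).1. Qed.

Lemma limn_einf_ge (R : realType) (c : \bar R) (u : (\bar R)^nat) :
  (forall n, (c <= u n)%E) -> (c <= limn_einf u)%E.
Proof.
by move=> cu; rewrite -[leLHS]limn_einf_cst; apply: le_limn_einf; near=> n.
Unshelve. all: by end_near. Qed.

Lemma limn_einf_le (R : realType) (c : \bar R) (u : (\bar R)^nat) :
  (forall n, (u n <= c)%E) -> (limn_einf u <= c)%E.
Proof.
by move=> cu; rewrite -[leRHS]limn_einf_cst; apply: le_limn_einf; near=> n.
Unshelve. all: by end_near. Qed.

(** Eventually [p n <= 1 + P], so that [|a n|^2 / (1 + P) <= q n]. The 1 leaves room above the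
    limit, also when [P = 0]. *)
Lemma sqr_lim_le_limn_einf (R : realType) (a : nat -> R[i]) (b : R[i])
    (p q : nat -> R) (P : R) :
  (a : nat -> R[i]^o) @ \oo --> (b : R[i]^o) -> p @ \oo --> P -> 0 <= P ->
  (forall n, 0 <= q n) -> (forall n, cabs (a n) ^+ 2 <= q n * p n) ->
  ((cabs b ^+ 2 / (1 + P))%:E <= limn_einf (fun n => (q n)%:E))%E.
Proof.
move=> ab pP P0 q0 h; have P1 : 0 < 1 + P by rewrite ltr_pwDl.
have ca : (cabs (a n) ^+ 2 / (1 + P))%:E @[n --> \oo] -->
    (cabs b ^+ 2 / (1 + P))%:E.
  apply: cvg_EFin; first by near=> n.
  apply: cvgMr_tmp; exact: (cvgM (cvg_rnorm ab) (cvg_rnorm ab)).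
rewrite -(cvg_limn_einf_sup ca).1; apply: le_limn_einf; near=> n.
rewrite lee_fin ler_pdivrMr//; apply: le_trans (h n) _; apply: ler_wpM2l => //.
by near: n; apply: (cvgr_le _ pP); rewrite ltrDr.
Unshelve. all: by end_near. Qed.

Import HBNNSimple.

(* The integral of a nonnegative function being the supremum of the integrals
   of its simple minorants, no measurability is needed here. *)
Lemma ae_le_lower_integral d (T : measurableType d) (R : realType)
    (mu : {measure set T -> \bar R}) (f g : T -> \bar R) :
  (forall x, 0 <= f x)%E -> (forall x, 0 <= g x)%E ->
  {ae mu, forall x, (f x <= g x)%E} ->
  (\int[mu]_x f x <= \int[mu]_x g x)%E.
Proof.
move=> f0 g0 [N [mN N0 fgN]]; rewrite !ge0_integralE// !patch_setT.
apply/ereal_supP => _ [h /= hf <-].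
(* The minorant [h] of [f] is cut off on the exceptional null set: it becomes a minorant of [g]
   everywhere, with the same integral. *)
pose h' := proj_nnsfun h (measurableC mN).
have h'E x : h' x = if x \in N then 0 else h x.
  rewrite /h'/= /mindic indicE in_setC; case: (x \in N) => /=.
    by rewrite mulr0.
  by rewrite mulr1.
apply: (@le_trans _ _ (sintegral mu h')).
  rewrite -!integralT_nnsfun; apply: ae_ge0_le_integral => //.
  - by move=> x _; rewrite lee_fin.
  - exact/measurable_EFinP.
  - by move=> x _; rewrite lee_fin.
  - exact/measurable_EFinP.
  - exists N; split => // x /= hx; apply: contrapT => xN; apply: hx => _.
    by rewrite lee_fin; have := h'E x; rewrite memNset//= => ->.
apply: ereal_sup_ubound; exists h' => //= x.
have /= -> := h'E x; case: ifPn => [_|/negP xN]; first exact: g0.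
apply: le_trans (hf x) _; apply: contrapT => h1; apply: xN.
by rewrite inE; apply: fgN.
Qed.

Lemma ae_eq_lower_integral d (T : measurableType d) (R : realType)
    (mu : {measure set T -> \bar R}) (f g : T -> \bar R) :
  (forall x, 0 <= f x)%E -> (forall x, 0 <= g x)%E ->
  {ae mu, forall x, f x = g x} ->
  (\int[mu]_x f x = \int[mu]_x g x)%E.
Proof.
move=> f0 g0 fg; apply/eqP; rewrite eq_le; apply/andP; split;
  apply: ae_le_lower_integral => //; apply: filterS fg => x -> //.
Qed.

(** * Square-summable sequences and fibers *)

Section SquareSummable.
Context (R : realType).
Implicit Types (u v w : nat -> R[i]) (a : R[i]).

Definition square_summable u := (l2_normsq u < +oo)%E.

Definition rnormsq u : R := limn (series (fun k => cabs (u k) ^+ 2)).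

Lemma Re_sqr_norm a : complex.Re (`|a| ^+ 2) = cabs a ^+ 2.
Proof. by rewrite cabsE -rmorphXn. Qed.

Lemma l2_normsqE u : l2_normsq u = (\sum_(0 <= k <oo) (cabs (u k) ^+ 2)%:E)%E.
Proof. by apply: eq_eseriesr => k _; rewrite Re_sqr_norm. Qed.

Lemma l2_normsq_ge0 u : (0 <= l2_normsq u)%E.
Proof.
by rewrite l2_normsqE; apply: nneseries_ge0 => k _ _; rewrite lee_fin sqr_ge0.
Qed.

Lemma square_summableP u :
  square_summable u <-> cvgn (series (fun k => cabs (u k) ^+ 2)).
Proof.
have nd : nondecreasing_seq (series (fun k => cabs (u k) ^+ 2)).
  by apply: nondecreasing_series => k _ _; exact: sqr_ge0.
split.
  move=> uoo; apply: nondecreasing_is_cvgn => //.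
  have fin : l2_normsq u \is a fin_num.
    by rewrite ge0_fin_numE// l2_normsq_ge0.
  exists (fine (l2_normsq u)) => _ [n _ <-].
  rewrite -lee_fin fineK// l2_normsqE /series/= -sumEFin.
  by apply: nneseries_lim_ge => k _ _; rewrite lee_fin sqr_ge0.
move=> cu; rewrite /square_summable l2_normsqE.
have : (fun n => \sum_(0 <= k < n) (cabs (u k) ^+ 2)%:E)%E @ \oo -->
   (rnormsq u)%:E.
  under eq_fun do rewrite sumEFin.
  by apply: cvg_EFin => //; near=> n.
by move/cvg_lim => -> //; rewrite ltry.
Unshelve. all: by end_near. Qed.

Lemma cvg_rnormsq u : square_summable u ->
  series (fun k => cabs (u k) ^+ 2) @ \oo --> rnormsq u.
Proof. by move=> /square_summableP. Qed.

Lemma l2_normsq_fin u : square_summable u -> l2_normsq u = (rnormsq u)%:E.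
Proof.
move=> /square_summableP cu; rewrite l2_normsqE.
apply/cvg_lim => //; under eq_fun do rewrite sumEFin.
by apply: cvg_EFin => //; near=> n.
Unshelve. all: by end_near. Qed.

Lemma rnormsq_ge0 u : square_summable u -> 0 <= rnormsq u.
Proof. by move=> su; rewrite -lee_fin -l2_normsq_fin// l2_normsq_ge0. Qed.

Lemma square_summable_comb a u v : square_summable u -> square_summable v ->
  square_summable (fun k => a * u k + v k).
Proof.
move=> /square_summableP su /square_summableP sv; apply/square_summableP.
apply: (@series_le_cvg _ _
  (fun k => 2 * cabs a ^+ 2 * cabs (u k) ^+ 2 + 2 * cabs (v k) ^+ 2)).
- by move=> k; exact: sqr_ge0.
- move=> k.
  by do ![apply: addr_ge0|exact: sqr_ge0|exact: ler0n|apply: mulr_ge0].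
- move=> k; apply: (@le_trans _ _ ((cabs a * cabs (u k) + cabs (v k)) ^+ 2)).
    rewrite lerXn2r ?nnegrE ?addr_ge0 ?mulr_ge0 ?rnorm_ge0//.
    by rewrite -cabsM; exact: (@ler_rnormD _ R[i]^o).
  have := sqr_ge0 (cabs a * cabs (u k) - cabs (v k)); nra.
by rewrite seriesD; apply: is_cvgD; apply: is_cvg_seriesZ.
Qed.

Lemma square_summable0 : square_summable (fun=> 0).
Proof.
apply/square_summableP; rewrite (_ : series _ = fun=> 0); first exact: is_cvg_cst.
by apply/funext => n; rewrite /series/= big1// => k _; rewrite rnorm0 expr0n.
Qed.

Lemma square_summableZ a u : square_summable u ->
  square_summable (fun k => a * u k).
Proof.
move=> su; have := square_summable_comb a su square_summable0.
by under eq_fun do rewrite addr0.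
Qed.

(** [l2_inner] is defined by [limn], which is meaningful only once convergence is known. The real
    and imaginary parts of the terms are dominated by [|u k|^2 + |v k|^2]. *)
Lemma cvg_l2_inner u v : square_summable u -> square_summable v ->
  (series (fun k => Num.conj (u k) * v k : R[i]^o)) @ \oo -->
  (l2_inner u v : R[i]^o).
Proof.
move=> /square_summableP su /square_summableP sv.
pose p k := Num.conj (u k) * v k.
have pb k : cabs (p k) <= cabs (u k) ^+ 2 + cabs (v k) ^+ 2.
  rewrite cabsM conjE cabsJ; have := sqr_ge0 (cabs (u k) - cabs (v k)).
  by have := sqr_ge0 (cabs (u k) + cabs (v k)); nra.
have cuv : cvgn (series (fun k => cabs (u k) ^+ 2 + cabs (v k) ^+ 2)).
  by rewrite seriesD; exact: is_cvgD.
have dom (q : nat -> R) : (forall k, `|q k| <= cabs (p k)) -> cvgn (series q).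
  move=> hq; apply: normed_cvg; apply: series_le_cvg cuv => k.
  - exact: normr_ge0.
  - by rewrite addr_ge0 ?sqr_ge0.
  - exact: le_trans (hq k) (pb k).
have cRe := dom (fun k => complex.Re (p k)) (fun k => Re_le_cabs _).
have cIm := dom (fun k => complex.Im (p k)) (fun k => Im_le_cabs _).
suff h : cvgn (series (fun k => p k : R[i]^o)) by exact: h.
apply/cvg_ex; exists (limn (series (fun k => complex.Re (p k))) +i*
                     limn (series (fun k => complex.Im (p k)))).
apply/cvg_complexP; split => /=.
  by under eq_cvg do rewrite /series/= Re_sum.
by under eq_cvg do rewrite /series/= Im_sum.
Qed.

Lemma l2_inner_comb a u v w :
  square_summable u -> square_summable v -> square_summable w ->
  l2_inner (fun k => a * u k + v k) w = conjc a * l2_inner u w + l2_inner v w.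
Proof.
move=> su sv sw.
apply: (complex_cvg_unique (cvg_l2_inner (square_summable_comb a su sv) sw)).
have -> : series (fun k => Num.conj (a * u k + v k) * w k : R[i]^o) =
    (fun n => (conjc a : R[i]^o) *: series (fun k => Num.conj (u k) * w k : R[i]^o) n +
      series (fun k => Num.conj (v k) * w k : R[i]^o) n).
  apply/funext => n; rewrite /series/= scaler_sumr -big_split/=.
  by apply: eq_bigr => k _; rewrite rmorphD rmorphM mulrDl -mulrA.
apply: (@cvgD _ R[i]^o _ _ _ _ _ (conjc a *: (l2_inner u w : R[i]^o))).
  by apply: cvgZl_tmp; exact: (cvg_l2_inner su sw).
exact: (cvg_l2_inner sv sw).
Qed.

Lemma l2_innerJ u v : square_summable u -> square_summable v ->
  l2_inner u v = conjc (l2_inner v u).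
Proof.
move=> su sv; apply: (complex_cvg_unique (cvg_l2_inner su sv)).
have /cvg_complexP[h1 h2] := cvg_l2_inner sv su.
apply/cvg_complexP; rewrite ReJ ImJ; split.
  apply: cvg_trans h1; apply: near_eq_cvg; near=> n.
  by rewrite /series/= !Re_sum; apply: eq_bigr => k _; rewrite -ReJ conjcM conjcK mulrC.
apply: cvg_trans (cvgN h2); apply: near_eq_cvg; near=> n.
rewrite /series/= !Im_sum opprfctE Im_sum -sumrN; apply: eq_bigr => k _.
by rewrite -ImJ conjcM conjcK mulrC.
Unshelve. all: by end_near. Qed.

Lemma l2_innerxx u : square_summable u -> l2_inner u u = (rnormsq u)%:C.
Proof.
move=> su; apply: (complex_cvg_unique (cvg_l2_inner su su)).
apply/cvg_complexP; split => /=.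
  apply: cvg_trans (cvg_rnormsq su); apply: near_eq_cvg; near=> n.
  by rewrite /series/= Re_sum; apply: eq_bigr => k _; rewrite mulJc.
apply: cvg_near_cst; near=> n.
by rewrite /series/= Im_sum big1// => k _; rewrite mulJc.
Unshelve. all: by end_near. Qed.

Lemma rnormsq_comb a u v : square_summable u -> square_summable v ->
  rnormsq (fun k => a * u k + v k) =
  cabs a ^+ 2 * rnormsq u + rnormsq v + 2 * complex.Re (conjc a * l2_inner u v).
Proof.
move=> su sv; apply: complexI; have sw := square_summable_comb a su sv.
rewrite -l2_innerxx// l2_inner_comb//.
rewrite (l2_innerJ su sw) (l2_innerJ sv sw) !l2_inner_comb// !l2_innerxx//.
rewrite (l2_innerJ sv su) !conjcD !conjcM !conjcK conjc_real mulrDr mulrA mulJc.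
rewrite !conjc_real !rmorphD/= [in RHS]rmorphM/=.
case: (l2_inner u v) => p q; case: (a) => r s.
apply/eqP; rewrite eq_complex/=; apply/andP; split;
  apply/eqP; ring.
Qed.

Lemma rnormsq0 : rnormsq (fun=> 0) = 0.
Proof.
rewrite /rnormsq (_ : series _ = fun=> 0) ?lim_cst//.
by apply/funext => n; rewrite /series/= big1// => k _; rewrite rnorm0 expr0n.
Qed.

Lemma l2_inner0l w : l2_inner (fun=> 0) w = 0.
Proof.
rewrite /l2_inner (_ : series _ = fun=> 0) ?lim_cst//.
by apply/funext => n; rewrite /series/= big1// => k _; rewrite rmorph0 mul0r.
Qed.

Lemma l2_inner0r w : l2_inner w (fun=> 0) = 0.
Proof.
rewrite /l2_inner (_ : series _ = fun=> 0) ?lim_cst//.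
by apply/funext => n; rewrite /series/= big1// => k _; rewrite mulr0.
Qed.

Lemma l2_innerZl a u w : square_summable u -> square_summable w ->
  l2_inner (fun k => a * u k) w = conjc a * l2_inner u w.
Proof.
move=> su sw; have := l2_inner_comb a su square_summable0 sw.
by rewrite l2_inner0l addr0 => <-; under [in RHS]eq_fun do rewrite addr0.
Qed.

Lemma rnormsqZ a u : square_summable u ->
  rnormsq (fun k => a * u k) = cabs a ^+ 2 * rnormsq u.
Proof.
move=> su; have s0 := square_summable0.
have := rnormsq_comb a su s0; under [in LHS]eq_fun do rewrite addr0.
rewrite rnormsq0 l2_inner0r.
by rewrite mulr0/= mulr0 !addr0.
Qed.

Lemma l2_cauchy_schwarz u v : square_summable u -> square_summable v ->
  cabs (l2_inner u v) ^+ 2 <= rnormsq u * rnormsq v.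
Proof.
move=> su sv; set b := l2_inner u v.
have n0 := rnormsq_ge0 su; have m0 := rnormsq_ge0 sv.
set n := rnormsq u in n0 *; set m := rnormsq v in m0 *.
(* The squared norm of [v - t <u, v> u], a polynomial of degree at most 2 in [t]. *)
have q (t : R) : 0 <= t ^+ 2 * cabs b ^+ 2 * n + m - 2 * t * cabs b ^+ 2.
  have := rnormsq_ge0 (square_summable_comb (- t%:C * b) su sv).
  have E : conjc (- t%:C * b) * b = - (t * cabs b ^+ 2)%:C.
    by rewrite conjcM conjcN conjc_real -mulrA mulJc mulNr -real_complexM.
  rewrite rnormsq_comb// -/b -/m -/n E ReN/= cabsM exprMn.
  rewrite (_ : cabs (- t%:C) = `|t|); last by rewrite -cabsR; exact: (@rnormN _ R[i]^o).
  by rewrite real_normK ?num_real//; lra.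
have [n1|] := ltP 0 n; last first.
  move=> n1; have nE : n = 0 by apply/eqP; rewrite eq_le n1 n0.
  rewrite nE mul0r leNgt; apply/negP => b0.
  (* When [n = 0] the polynomial is affine in [t], and this value of [t] would make it
     [- m - 2 < 0]. *)
  have := q ((m + 1) / cabs b ^+ 2); rewrite nE mulr0 add0r.
  by rewrite -mulrA divfK ?gt_eqF//; lra.
have := q n^-1.
have -> : n^-1 ^+ 2 * cabs b ^+ 2 * n + m - 2 * n^-1 * cabs b ^+ 2 =
    (n * m - cabs b ^+ 2) / n by field; rewrite gt_eqF.
by rewrite pmulr_lge0 ?invr_gt0// subr_ge0.
Qed.

Lemma square_summable_sum (c : nat -> R[i]) (f : nat -> nat -> R[i]) n :
  (forall j, square_summable (f j)) ->
  square_summable (fun k => \sum_(j < n) c j * f j k).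
Proof.
move=> sf; elim: n => [|n ih].
  by under eq_fun do rewrite big_ord0; exact: square_summable0.
under eq_fun do rewrite big_ord_recr/= addrC.
exact: square_summable_comb.
Qed.

Lemma l2_inner_suml (c : nat -> R[i]) (f : nat -> nat -> R[i]) n w :
  (forall j, square_summable (f j)) -> square_summable w ->
  l2_inner (fun k => \sum_(j < n) c j * f j k) w =
  \sum_(j < n) conjc (c j) * l2_inner (f j) w.
Proof.
move=> sf sw; elim: n => [|n ih].
  by under eq_fun do rewrite big_ord0; rewrite big_ord0 l2_inner0l.
under eq_fun do rewrite big_ord_recr/= addrC.
by rewrite l2_inner_comb//; [rewrite ih big_ord_recr/= addrC|exact: square_summable_sum].
Qed.

(** Subtracting from [u] a finite combination of the [f j] does not change its inner product with
    [w], and the remainder can be made arbitrarily small. *)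
Lemma closed_span_orthogonal (f : nat -> nat -> R[i]) u w :
  (forall j, square_summable (f j)) -> l2_closed_span f u -> square_summable w ->
  (forall j, l2_inner (f j) w = 0) -> l2_inner u w = 0.
Proof.
move=> sf [su hu] sw fw; apply/cabs_eq0/eqP; rewrite -sqrf_eq0.
rewrite eq_le sqr_ge0 andbT; apply/ler_addgt0Pl => e e0; rewrite addr0.
have w1 : 0 < 1 + rnormsq w by rewrite ltr_pwDl// rnormsq_ge0.
have [n [c hc]] := hu (e / (1 + rnormsq w)) (divr_gt0 e0 w1).
have sc := square_summable_sum c n sf.
set v := fun k => \sum_(j < n) c j * f j k in sc.
pose d k := -1 * v k + u k.
have sd : square_summable d by exact: square_summable_comb.
have -> : l2_inner u w = l2_inner d w.
  rewrite /d l2_inner_comb// /v l2_inner_suml// big1 ?mulr0 ?add0r//.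
  by move=> j _; rewrite fw mulr0.
have dE : d = fun k => u k - \sum_(j < n) c j * f j k.
  by apply/funext => k; rewrite /d mulN1r addrC.
rewrite -dE l2_normsq_fin// lte_fin in hc.
apply: le_trans (l2_cauchy_schwarz sd sw) _.
have d0 := rnormsq_ge0 sd; have w0 := rnormsq_ge0 sw.
rewrite ltr_pdivlMr// in hc; nra.
Qed.

Lemma closed_spanZ (f : nat -> nat -> R[i]) a u :
  (forall j, square_summable (f j)) -> l2_closed_span f u ->
  l2_closed_span f (fun k => a * u k).
Proof.
move=> sf [su hu]; split; first exact: square_summableZ.
move=> e e0; have a1 : 0 < 1 + cabs a ^+ 2 by rewrite ltr_pwDl// sqr_ge0.
have [n [c hc]] := hu (e / (1 + cabs a ^+ 2)) (divr_gt0 e0 a1).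
exists n, (fun j => a * c j).
have sc := square_summable_sum c n sf.
pose d k := u k - \sum_(j < n) c j * f j k.
have sd : square_summable d.
  have := square_summable_comb (-1) sc su.
  by under eq_fun do rewrite mulN1r addrC.
rewrite -/d l2_normsq_fin// lte_fin ltr_pdivlMr// in hc.
have -> : (fun k => a * u k - \sum_(j < n) a * c j * f j k) = fun k => a * d k.
  apply/funext => k; rewrite /d mulrBr mulr_sumr; congr (_ - _).
  by apply: eq_bigr => j _; rewrite mulrA.
rewrite l2_normsq_fin; last exact: square_summableZ.
rewrite rnormsqZ// lte_fin; have d0 := rnormsq_ge0 sd; nra.
Qed.

End SquareSummable.

(** * Square roots of infinite matrices and the vectors [phi_at] *)

Section SquareRootMatrix.
Context (R : realType).

Lemma sum_delta n i (f : nat -> R[i]) : (i < n)%N ->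
  \sum_(q < n) f q * (nat_of_ord q == i)%:R = f i.
Proof.
move=> ni; rewrite (bigD1 (Ordinal ni))//= eqxx mulr1 big1 ?addr0// => q qi.
rewrite (_ : (nat_of_ord q == i) = false) ?mulr0//.
by apply: contra_neqF qi => /eqP qi; apply: val_inj.
Qed.

(** Polarization: the form is real at [a e_i + b e_j], and the pairs
    [(a, b) = (1, 0), (0, 1), (1, 1), (1, i)] determine the relation between [B i j] and [B j i].
    Writing the vector as a sum of two delta sequences also covers [i = j]. *)
Lemma psd_mat_hermitian (B : nat -> nat -> R[i]) :
  (forall n (c : nat -> R[i]),
    0 <= \sum_(i < n) \sum_(j < n) Num.conj (c i) * B i j * c j) ->
  forall i j, B j i = conjc (B i j).
Proof.
move=> Bpos.
have key i j (a b : R[i]) :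
    complex.Im (conjc a * (B i i * a + B i j * b) +
                conjc b * (B j i * a + B j j * b)) = 0.
  pose n := (maxn i j).+1.
  have ni : (i < n)%N by rewrite ltnS leq_maxl.
  have nj : (j < n)%N by rewrite ltnS leq_maxr.
  pose c (k : nat) : R[i] := a * (k == i)%:R + b * (k == j)%:R.
  have := ger0_Im (Bpos n c).
  have E p : \sum_(q < n) Num.conj (c p) * B p q * c q =
      Num.conj (c p) * (B p i * a + B p j * b).
    under eq_bigr do rewrite mulrDr !mulrA.
    rewrite big_split/= (sum_delta (fun q => Num.conj (c p) * B p q * a))//.
    rewrite (sum_delta (fun q => Num.conj (c p) * B p q * b))//.
    by rewrite mulrDr !mulrA.
  under eq_bigr do rewrite E.
  have E' (p : nat) : Num.conj (c p) * (B p i * a + B p j * b) =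
      conjc a * (B p i * a + B p j * b) * (p == i)%:R +
      conjc b * (B p i * a + B p j * b) * (p == j)%:R.
    rewrite conjE /c conjcD !conjcM !conjc_nat mulrDl.
    by rewrite ![_ * (_ == _)%:R * _]mulrAC.
  under eq_bigr do rewrite E'.
  rewrite big_split/= (sum_delta (fun p => conjc a * (B p i * a + B p j * b)))//.
  by rewrite (sum_delta (fun p => conjc b * (B p i * a + B p j * b))).
move=> i j.
have := key i j 1 0; have := key i j 0 1; have := key i j 1 1.
have := key i j 1 'i.
case: (B i i) (B i j) (B j i) (B j j) => [a a'] [b b'] [c c'] [d d'] /=.
move=> h1 h2 h3 h4; apply/eqP; rewrite eq_complex/=; apply/andP; split;
  apply/eqP; lra.
Qed.

(** For Hermitian [B], the equation [B^2 = M] says that [M] is the Gram matrix of the columns of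
    [B], the form needed for the fibers. The second case is the default value of [xget]. *)
Variant sqrt_mat_spec (M : nat -> nat -> R[i]) : (nat -> nat -> R[i]) -> Prop :=
| SqrtMat B of (forall j, square_summable (fun k => B k j)) &
    (forall i j, l2_inner (fun k => B k i) (fun k => B k j) = M i j) :
    sqrt_mat_spec M B
| NoSqrtMat : sqrt_mat_spec M (fun _ _ => 0).

Lemma sqrt_matP M : sqrt_mat_spec M (sqrt_mat M).
Proof.
rewrite /sqrt_mat; case: xgetP => [B _ [Bpos BM]|_]; last exact: NoSqrtMat.
have Bh := psd_mat_hermitian Bpos.
have sB j : square_summable (fun k => B k j).
  have /cvg_complexP[h _] := BM j j.
  apply/square_summableP/cvg_ex; exists (complex.Re (M j j)).
  apply: cvg_trans h; apply: near_eq_cvg; near=> n.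
  rewrite /series/= Re_sum; apply: eq_bigr => k _.
  by rewrite (Bh k j) mulJc.
apply: SqrtMat => // i j.
apply: (complex_cvg_unique (cvg_l2_inner (sB i) (sB j))).
apply: cvg_trans (BM i j); apply: near_eq_cvg; near=> n.
by rewrite /series/=; apply: eq_bigr => k _; rewrite (Bh k i).
Unshelve. all: by end_near. Qed.

End SquareRootMatrix.

Section FiberVectors.
Context (R : realType) (V W : hilbertType R) (A : operator V) (F : frame V W).

Lemma square_summable_phi_at l j : square_summable (phi_at A F j l).
Proof.
rewrite /phi_at; case: asboolP => _; last exact: square_summable0.
rewrite /eta_mat; case: sqrt_matP => [B sB _|]; first exact: square_summableZ.
by under eq_fun do rewrite mulr0; exact: square_summable0.
Qed.

(* Where the square root of [phi_mat] does not exist, or outside [Lambda],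
   [phi_at] vanishes and the fiber is trivial. *)
Lemma phi_at_inner l : Lambda A F l -> (exists j, phi_at A F j l <> fun=> 0) ->
  forall i j, l2_inner (phi_at A F i l) (phi_at A F j l) =
    (pi^-1)%:C *
    lim ((poisson_form A l y (phi F i) (phi F j) : R[i]^o) @[y --> 0^'+]).
Proof.
move=> Ll [j0 nz] i j; move: nz; rewrite /phi_at asboolT// /eta_mat.
case: sqrt_matP => [B sB BM _|]; last first.
  by case; apply/funext => k; rewrite mulr0.
have k0 m : kappa F m != 0 by rewrite gt_eqF// kappa_gt0.
pose b m := fun k => ((kappa F m)^-1)%:C * B k m.
have sb m : square_summable (b m) by exact: square_summableZ.
have lin m w : square_summable w -> l2_inner (b m) w =
    ((kappa F m)^-1)%:C * l2_inner (fun k => B k m) w.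
  by move=> sw; rewrite l2_innerZl// conjc_real.
rewrite -/(b i) -/(b j) lin// (l2_innerJ (sB i) (sb j)) lin//.
rewrite conjcM conjc_real -(l2_innerJ (sB i) (sB j)) BM /phi_mat.
rewrite /poisson_form; set L := lim _.
transitivity (((kappa F i)^-1)%:C * (kappa F i)%:C *
  (((kappa F j)^-1)%:C * (kappa F j)%:C) * ((pi^-1)%:C * L)); first by ring.
by rewrite -!real_complexM !mulVf// mul1r mul1r.
Qed.

End FiberVectors.

(** Limits as [y] tends to 0 are taken along [c / (n + 1)], since Fatou's lemma works with
    sequences; [c = 1] and [c = 2] are the two scales of [smooth_form]. *)
Lemma cvg_harmonic_at_right (R : realType) (c : R) : 0 < c ->
  c * n.+1%:R^-1 @[n --> \oo] --> 0^'+.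
Proof.
move=> c0 P hP.
have h : c * n.+1%:R^-1 @[n --> \oo] --> (0 : R).
  by rewrite -(mulr0 c); apply: cvgM; [exact: cvg_cst|exact: cvg_harmonic].
have hn : \forall n \near \oo, 0 < c * n.+1%:R^-1 -> P (c * n.+1%:R^-1).
  exact: h _ hP.
suff : \forall n \near \oo, P (c * n.+1%:R^-1) by [].
by apply: filterS hn => n; apply; rewrite mulr_gt0// invr_gt0.
Qed.

(** * Boundary values *)

Section LambdaLimits.
Context (R : realType) (V W : hilbertType R) (A : operator V) (F : frame V W).
Hypothesis hA : self_adjoint A.
Implicit Types (l y : R) (f g : V).

(** Norm convergence of [F R_z F^*] gives that of its entries [kappa_i kappa_j <phi_i, R_z phi_j>].
    Dividing by the [kappa] yields limits of [r i j], and the entries of the imaginary part are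
    [(r i j - conjc (r j i)) / 2i]. *)
Lemma Lambda_cvg l i j : Lambda A F l ->
  cvg ((poisson_form A l y (phi F i) (phi F j) : R[i]^o) @[y --> 0^'+]).
Proof.
move=> [[T _ hT] _].
pose r i j y := inner (phi F i) (resolvent A (l +i* y) (phi F j)).
pose t i j := inner (psi F i) (T (psi F j)) / ((kappa F i)%:C * (kappa F j)%:C).
have y0 : \forall y \near 0^'+, (y : R) != 0.
  near=> y; rewrite gt_eqF//; near: y; exact: nbhs_right_gt.
have rt p q : (r p q y : R[i]^o) @[y --> 0^'+] --> (t p q : R[i]^o).
  pose D y x := sandwich F (resolvent A (l +i* y)) x - T x.
  have hD : rnorm (D y (psi F q)) @[y --> 0^'+] --> (0 : R).
    apply: (@fine_cvg _ _ _ _ (fun y => (rnorm (D y (psi F q)))%:E)).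
    apply: (@squeeze_cvge _ _ _ _ (fun=> 0%E) _ (fun y => op_norm (D y))).
    - near=> y; rewrite lee_fin rnorm_ge0/=; apply: ereal_sup_ubound.
      by exists (psi F q) => //=; rewrite (rnorm_orthonormal (psi_basis F).1).
    - exact: cvg_cst.
    - exact: hT.
  have hi : (inner (psi F p) (D y (psi F q)) : R[i]^o) @[y --> 0^'+] --> (0 : R[i]^o).
    apply/cvg_rnormP.
    apply: (@squeeze_cvgr _ _ _ _ (fun=> 0) (fun y => rnorm (D y (psi F q)))) => //.
    - near=> y; rewrite rnorm_ge0/= subr0.
      have := cauchy_schwarz (psi F p) (D y (psi F q)).
      by rewrite (rnorm_orthonormal (psi_basis F).1) mul1r.
    - exact: cvg_cst.
  set k := (kappa F p)%:C * (kappa F q)%:C in t *.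
  have k0 : k != 0.
    by rewrite /k -real_complexM; apply/eqP => /complexI/eqP;
      rewrite mulf_eq0 !gt_eqF// kappa_gt0.
  have h : (k^-1 *: (inner (psi F p) (D y (psi F q)) : R[i]^o) + t p q : R[i]^o)
      @[y --> 0^'+] --> (k^-1 *: (0 : R[i]^o) + t p q : R[i]^o).
    by apply: cvgD; [exact: cvgZl_tmp|exact: cvg_cst].
  rewrite scaler0 add0r in h.
  apply: cvg_trans h; apply: near_eq_cvg; near=> y.
  have yn0 : y != 0 by near: y.
  rewrite /= /GRing.scale/= /D innerBr sandwich_entry (resolventZ hA)//.
  rewrite innerZr mulrBr /t -/k [inner _ _ / k]mulrC subrK mulrA -/k mulrA.
  by rewrite mulVf// mul1r.
apply/cvg_ex; exists ((2 * 'i)^-1 *: (t i j - conjc (t j i)) : R[i]^o).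
have h : ((2 * 'i)^-1 *: (r i j y - conjc (r j i y)) : R[i]^o) @[y --> 0^'+] -->
   ((2 * 'i)^-1 *: (t i j - conjc (t j i)) : R[i]^o).
  apply: cvgZl_tmp; apply: cvgB; first exact: rt.
  have /cvg_complexP[h1 h2] := rt j i; apply/cvg_complexP; split.
    by rewrite ReJ; under eq_cvg do rewrite ReJ.
  by rewrite ImJ; under eq_cvg do rewrite ImJ; exact: cvgN.
apply: cvg_trans h; apply: near_eq_cvg; near=> y.
have yn0 : y != 0 by near: y.
rewrite /poisson_form /im_op.
rewrite (adjointE (fun u v => resolvent_adj hA (z := l +i* y) u v yn0)).
rewrite innerZr innerBr -(resolvent_adj hA)//.
by rewrite /r [inner (resolvent _ _ _) _]inner_conj.
Unshelve. all: by end_near. Qed.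

Definition poisson_lim l i j : R[i] :=
  lim ((poisson_form A l y (phi F i) (phi F j) : R[i]^o) @[y --> 0^'+]).

Lemma poisson_lim_seq l i j (c : R) : Lambda A F l -> 0 < c ->
  (poisson_form A l (c * n.+1%:R^-1) (phi F i) (phi F j) : R[i]^o)
    @[n --> \oo] --> (poisson_lim l i j : R[i]^o).
Proof.
move=> Ll c0; have h := @Lambda_cvg l i j Ll.
exact: (cvg_comp _ _ (cvg_harmonic_at_right c0) h).
Qed.

Lemma smooth_lim_seq l i j : Lambda A F l ->
  (smooth_form A l n.+1%:R^-1 (phi F i) (phi F j) : R[i]^o)
    @[n --> \oo] --> (2^-1 * poisson_lim l i j : R[i]^o).
Proof.
move=> Ll; have h1 := poisson_lim_seq (i := i) (j := j) Ll ltr01.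
have h2 := poisson_lim_seq (i := i) (j := j) Ll (ltr0n R 2).
pose proof (cvgB h1 (complex_cvgMl (c := 2^-1) h2)) as h.
have E : poisson_lim l i j - 2^-1 * poisson_lim l i j =
    2^-1 * poisson_lim l i j by field.
rewrite E in h; apply: cvg_trans h; apply: near_eq_cvg; near=> n.
by rewrite !fctE mul1r.
Unshelve. all: by end_near. Qed.

(** The difference equals [y (<f, R_z g> - i y <R_z f, R_z g>)]. Both terms are bounded by
    [|f| y |R_z g|], the second through [y |R_z f| <= |f|], and [y |R_z g|] is the square root of
    [y u_y(g, g)]. *)
Lemma poisson_form_mul l y f g : 0 < y -> op_dom A f ->
  cabs (poisson_form A l y (A f) g - l%:C * poisson_form A l y f g) <=
  2 * rnorm f * Num.sqrt (y * complex.Re (poisson_form A l y g g)).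
Proof.
move=> y_gt0 df; have y0 : y != 0 by rewrite gt_eqF.
rewrite poisson_formxx//= mulrA -expr2 -exprMn sqrtr_sqr.
rewrite ger0_norm ?mulr_ge0 ?rnorm_ge0 ?(ltW y_gt0)//.
rewrite !poisson_formE//; set z := l +i* y; set Rg := resolvent A z g.
have -> : resolvent A z (A f) = f + z *: resolvent A z f.
  have := resolventE hA (z := z) y0 df.
  by rewrite (resolventB hA)// (resolventZ hA)// => /(canRL (subrK _)).
rewrite innerDl innerZl.
set a := inner f Rg; set b := inner _ Rg.
have -> : y%:C * (a + conjc z * b) - l%:C * (y%:C * b) =
    y%:C * (a - (0 +i* y) * b).
  have -> : conjc z = l%:C - (0 +i* y).
    by apply/eqP; rewrite eq_complex/= subr0 add0r !eqxx.
  ring.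
rewrite cabsM cabsR (gtr0_norm y_gt0).
have ha : cabs a <= rnorm f * rnorm Rg by exact: cauchy_schwarz.
have hb : y * cabs b <= rnorm f * rnorm Rg.
  apply: le_trans (ler_wpM2l (ltW y_gt0) (cauchy_schwarz _ _)) _.
  rewrite mulrA; apply: ler_wpM2r; first exact: rnorm_ge0.
  by have := resolvent_bound hA (z := z) f y0; rewrite /= gtr0_norm.
have hab : cabs (a - (0 +i* y) * b) <= 2 * (rnorm f * rnorm Rg).
  apply: le_trans (ler_cabsD _ _) _; rewrite cabsN cabsM.
  have -> : cabs (0 +i* y) = y.
    have : cabs (0 +i* y) ^+ 2 = y ^+ 2 by rewrite cabs_sqr/= expr0n add0r.
    by move=> /eqP; rewrite eqrXn2 ?rnorm_ge0 ?(ltW y_gt0)// => /eqP.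
  by lra.
by have := ler_wpM2l (ltW y_gt0) hab; lra.
Qed.

Lemma poisson_form_mul_cvg l f j (c : R) : Lambda A F l -> op_dom A f -> 0 < c ->
  (poisson_form A l (c * n.+1%:R^-1) (A f) (phi F j) -
   l%:C * poisson_form A l (c * n.+1%:R^-1) f (phi F j) : R[i]^o)
    @[n --> \oo] --> (0 : R[i]^o).
Proof.
move=> Ll df c0; apply/cvg_rnormP; pose y n : R := c * n.+1%:R^-1.
have y0 n : 0 < y n by rewrite mulr_gt0// invr_gt0.
pose u n := 2 * rnorm f *
  Num.sqrt (y n * complex.Re (poisson_form A l (y n) (phi F j) (phi F j))).
apply: (@squeeze_cvgr _ _ _ _ (fun=> 0) u).
- by near=> n; rewrite rnorm_ge0/= subr0; apply: (poisson_form_mul _ _ (y0 _)).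
- exact: cvg_cst.
- rewrite -(mulr0 (2 * rnorm f)); apply: cvgM; first exact: cvg_cst.
  rewrite -[X in _ --> X](@sqrtr0 R); apply: continuous_cvg.
    exact: sqrt_continuous.
  have /cvg_complexP[h _] := poisson_lim_seq (i := j) (j := j) Ll c0.
  rewrite -(mul0r (complex.Re (poisson_lim l j j))); apply: cvgM h.
  by rewrite -(mulr0 c); apply: cvgM; [exact: cvg_cst|exact: cvg_harmonic].
Unshelve. all: by end_near. Qed.

Lemma smooth_form_mul_cvg l f j : Lambda A F l -> op_dom A f ->
  (smooth_form A l n.+1%:R^-1 (A f) (phi F j) -
   l%:C * smooth_form A l n.+1%:R^-1 f (phi F j) : R[i]^o)
    @[n --> \oo] --> (0 : R[i]^o).
Proof.
move=> Ll df; have h1 := poisson_form_mul_cvg j Ll df ltr01.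
have h2 := poisson_form_mul_cvg j Ll df (ltr0n R 2).
pose proof (cvgB h1 (complex_cvgMl (c := 2^-1) h2)) as h; rewrite mulr0 subr0 in h.
apply: cvg_trans h; apply: near_eq_cvg; near=> n.
rewrite !fctE /smooth_form mul1r; ring.
Unshelve. all: by end_near. Qed.

Lemma smooth_formBl l y f f' g :
  smooth_form A l y (f - f') g = smooth_form A l y f g - smooth_form A l y f' g.
Proof. by rewrite /smooth_form /poisson_form !innerBl; ring. Qed.

Lemma smooth_form_suml l y (c : nat -> R[i]) n g :
  smooth_form A l y (\sum_(0 <= i < n) c i *: phi F i) g =
  \sum_(0 <= i < n) conjc (c i) * smooth_form A l y (phi F i) g.
Proof.
rewrite /smooth_form /poisson_form !inner_suml mulr_sumr -sumrB.
by apply: eq_bigr => i _; rewrite !innerZl; ring.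
Qed.

(* [s] and [s'] majorize the smoothed densities of the errors [g - f] and
   [g' - A f] of approximation in the span of the [phi F i]. *)
Lemma multiplication_defect_bound l (N : R) f (c c' : nat -> R[i]) m j
    (s s' : nat -> R) :
  Lambda A F l -> op_dom A f -> `|l| <= N ->
  let g := \sum_(0 <= i < m) c i *: phi F i in
  let g' := \sum_(0 <= i < m) c' i *: phi F i in
  (forall n, complex.Re (smooth_form A l n.+1%:R^-1 (g - f) (g - f)) <= s n) ->
  (forall n, complex.Re (smooth_form A l n.+1%:R^-1 (g' - A f) (g' - A f)) <= s' n) ->
  ((cabs (2^-1 * (\sum_(0 <= i < m) conjc (c' i) * poisson_lim l i j -
          l%:C * \sum_(0 <= i < m) conjc (c i) * poisson_lim l i j)) ^+ 2 /
    (1 + complex.Re (2^-1 * poisson_lim l j j)))%:E <=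
   limn_einf (fun n => (2 * s' n + 2 * N ^+ 2 * s n)%:E))%E.
Proof.
move=> Ll df lN g g' hs hs'.
have y0 n : 0 < n.+1%:R^-1 :> R by rewrite invr_gt0.
pose Sm n h := complex.Re (smooth_form A l n.+1%:R^-1 h h).
have Sm0 n h : 0 <= Sm n h.
  rewrite /Sm smooth_formxx//=; apply: mulr_ge0 (sqr_ge0 _).
  by apply: mulr_ge0 => //; apply: exprn_ge0; exact: ltW.
(* [D] differs from the corresponding expression in [g] and [g'] only by the one in [f] and [A f],
   which tends to 0. Its limit is thus computed on frame vectors, while its size is controlled by
   the errors. *)
pose D n := smooth_form A l n.+1%:R^-1 (g' - A f) (phi F j) -
  l%:C * smooth_form A l n.+1%:R^-1 (g - f) (phi F j).
have /cvg_complexP[hP _] := smooth_lim_seq (i := j) (j := j) Ll.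
have P0 : 0 <= complex.Re (2^-1 * poisson_lim l j j).
  by apply: (ler_cvg_to (cvg_cst 0) hP); near=> n; exact: Sm0.
apply: (sqr_lim_le_limn_einf (a := D) (p := fun n => Sm n (phi F j))) => //.
- have sum_cvg (d : nat -> R[i]) :
    (\sum_(0 <= i < m) conjc (d i) * smooth_form A l n.+1%:R^-1 (phi F i) (phi F j) : R[i]^o)
      @[n --> \oo] --> (2^-1 * \sum_(0 <= i < m) conjc (d i) * poisson_lim l i j : R[i]^o).
    rewrite mulr_sumr; under eq_bigr do rewrite mulrCA.
    apply: complex_cvg_sum => i.
    exact: (complex_cvgMl (c := conjc (d i)) (smooth_lim_seq (i := i) (j := j) Ll)).
  pose proof (cvgB (cvgB (sum_cvg c') (complex_cvgMl (c := l%:C) (sum_cvg c)))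
                 (smooth_form_mul_cvg j Ll df)) as h.
  rewrite subr0 in h.
  rewrite mulrBr [2^-1 * (l%:C * _)]mulrCA.
  apply: cvg_trans h; apply: near_eq_cvg; near=> n.
  rewrite !fctE /D !smooth_formBl !smooth_form_suml; ring.
- move=> n; have s0 := le_trans (Sm0 n _) (hs n).
  have s'0 := le_trans (Sm0 n _) (hs' n).
  apply: addr_ge0; apply: mulr_ge0 => //.
  by apply: mulr_ge0 => //; exact: sqr_ge0.
- move=> n; have Sj := Sm0 n (phi F j).
  have h1 := smooth_form_cauchy_schwarz hA l (g' - A f) (phi F j) (y0 n).
  have h2 := smooth_form_cauchy_schwarz hA l (g - f) (phi F j) (y0 n).
  rewrite -!/(Sm n _) in h1 h2.
  set a := smooth_form A l _ (g' - A f) (phi F j) in h1.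
  set b := smooth_form A l _ (g - f) (phi F j) in h2.
  have N0 : 0 <= N by exact: le_trans lN.
  have hD : cabs (D n) <= cabs a + N * cabs b.
    rewrite /D -/a -/b; apply: le_trans (ler_cabsD _ _) _.
    by rewrite cabsN cabsM cabsR lerD2l ler_wpM2r// rnorm_ge0.
  apply: (@le_trans _ _ ((cabs a + N * cabs b) ^+ 2)).
    by rewrite lerXn2r ?nnegrE ?addr_ge0 ?mulr_ge0 ?rnorm_ge0.
  apply: (@le_trans _ _ (2 * cabs a ^+ 2 + 2 * N ^+ 2 * cabs b ^+ 2)).
    by have := sqr_ge0 (cabs a - N * cabs b); lra.
  have H1 := le_trans h1 (ler_wpM2r Sj (hs' n)).
  have H2 := ler_wpM2l (sqr_ge0 N) (le_trans h2 (ler_wpM2r Sj (hs n))).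
  by move: (Sm n (phi F j)) H1 H2 => S; lra.
Unshelve. all: by end_near. Qed.

End LambdaLimits.

(** * The evaluation operator *)

Section AlmostEverywhere.
Context (R : realType).
Implicit Types P Q S T : R -> Prop.

Let ae_filter : Filter (almost_everywhere (@lebesgue_measure R)) :=
  ae_filter_ringOfSetsType _.

Lemma ae_imply P Q : (forall l, P l -> Q l) ->
  {ae lebesgue_measure, forall l : R, P l} ->
  {ae lebesgue_measure, forall l : R, Q l}.
Proof. exact: (@filterS _ _ ae_filter). Qed.

Lemma ae_imply2 P Q S : (forall l, P l -> Q l -> S l) ->
  {ae lebesgue_measure, forall l : R, P l} ->
  {ae lebesgue_measure, forall l : R, Q l} ->
  {ae lebesgue_measure, forall l : R, S l}.
Proof. exact: (@filterS2 _ _ ae_filter). Qed.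

Lemma ae_imply3 P Q S T : (forall l, P l -> Q l -> S l -> T l) ->
  {ae lebesgue_measure, forall l : R, P l} ->
  {ae lebesgue_measure, forall l : R, Q l} ->
  {ae lebesgue_measure, forall l : R, S l} ->
  {ae lebesgue_measure, forall l : R, T l}.
Proof. exact: (@filterS3 _ _ ae_filter). Qed.

End AlmostEverywhere.

Lemma rnormsq_eq0 (R : realType) (u : nat -> R[i]) :
  square_summable u -> rnormsq u = 0 -> u = fun=> 0.
Proof.
move=> su u0; apply/funext => k; apply/cabs_eq0/eqP.
rewrite -sqrf_eq0 eq_le sqr_ge0 andbT -u0.
have nd : nondecreasing_seq (series (fun k => cabs (u k) ^+ 2)).
  by apply: nondecreasing_series => i _ _; exact: sqr_ge0.
apply: le_trans (nondecreasing_cvgn_le nd (cvgP _ (cvg_rnormsq su)) k.+1).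
by rewrite /series/= big_nat_recr//= lerDr sumr_ge0// => i _; exact: sqr_ge0.
Qed.

Lemma measurable_limn_einf (d : measure_display) (T : measurableType d)
    (R : realType) (f : nat -> T -> \bar R) :
  (forall n, measurable_fun setT (f n)) ->
  measurable_fun setT (fun x => limn_einf (fun n => f n x)).
Proof.
move=> mf.
rewrite (_ : (fun x => _) = -%E \o (fun x => limn_esup (fun n => - f n x)%E)).
  apply: measurableT_comp => //; apply: measurable_fun_limn_esup => n.
  exact: measurableT_comp.
apply/funext => x /=.
have /esym := limn_esupN (fun n => f n x).
by move=> /(congr1 -%E); rewrite oppeK.
Qed.

Section Evaluation.
Context (R : realType) (H K : hilbertType R) (H0 : operator H) (F : frame H K).
Context (E : H -> R -> nat -> R[i]).
Hypotheses (hH0 : self_adjoint H0) (hE : evaluation_operator H0 F E).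
Implicit Types (f g h : H) (l : R).

Let square_summable_E g l : square_summable (E g l).
Proof. by have [/(_ g)[/(_ l)[]]] := hE. Qed.

Let sphi j l : square_summable (phi_at H0 F j l) := square_summable_phi_at _ _ _ _.

Definition pairing j g l : R[i] := l2_inner (E g l) (phi_at H0 F j l).

Lemma pairing_lin (j : nat) a g h : {ae lebesgue_measure, forall l : R,
  pairing j (a *: g + h) l = conjc a * pairing j g l + pairing j h l}.
Proof.
have [_ /(_ a g h) + _ _] := hE; apply: ae_imply => l.
by rewrite /pairing => ->; rewrite l2_inner_comb.
Qed.

Lemma evaluation_sum (c : nat -> R[i]) n : {ae lebesgue_measure, forall l : R,
  E (\sum_(0 <= i < n) c i *: phi F i) l =
  fun k => \sum_(i < n) c i * phi_at H0 F i l k}.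
Proof.
have [_ Elin _ Ephi] := hE; elim: n => [|n ih].
  have := Elin (-1) 0 0; apply: ae_imply => l; rewrite big_nil scaler0 addr0 => ->.
  by apply/funext => k; rewrite big_ord0 mulN1r addNr.
apply: ae_imply3 ih (Elin (c n) (phi F n) (\sum_(0 <= i < n) c i *: phi F i)) (Ephi n).
move=> l ih1 + ephi; rewrite big_nat_recr//= addrC => ->.
by apply/funext => k; rewrite ih1 ephi big_ord_recr/= addrC.
Qed.

Lemma pairing_sum j (c : nat -> R[i]) n : {ae lebesgue_measure, forall l : R,
  pairing j (\sum_(0 <= i < n) c i *: phi F i) l =
  \sum_(0 <= i < n) conjc (c i) * l2_inner (phi_at H0 F i l) (phi_at H0 F j l)}.
Proof.
have := evaluation_sum c n; apply: ae_imply => l; rewrite /pairing => ->.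
by rewrite (l2_inner_suml c n (f := fun j => phi_at H0 F j l))// big_mkord.
Qed.

Lemma pairing_phi j : {ae lebesgue_measure, forall l : R,
  pairing j (phi F j) l = (rnormsq (phi_at H0 F j l))%:C}.
Proof.
have [_ _ _ /(_ j)] := hE; apply: ae_imply => l; rewrite /pairing => ->.
exact: l2_innerxx.
Qed.

(** Almost everywhere this is [1 / (1 + P)] with [P = (pi / 2) |phi_j(l)|^2], the denominator of
    [multiplication_defect_bound]. It is written through [pairing], whose measurability comes with
    [evaluation_operator]; the absolute value keeps it positive at every [l]. *)
Definition weight j l : R := (1 + pi / 2 * `|complex.Re (pairing j (phi F j) l)|)^-1.

Let den_gt0 j l : 0 < 1 + pi / 2 * `|complex.Re (pairing j (phi F j) l)|.
Proof. by rewrite ltr_pwDl// mulr_ge0// divr_ge0// pi_ge0. Qed.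

Lemma weight_gt0 j l : 0 < weight j l.
Proof. by rewrite invr_gt0. Qed.

Lemma measurable_Re_pairing j g :
  measurable_fun setT (fun l : measurableTypeR R => complex.Re (pairing j g l)).
Proof. by have [/(_ g)[_ /(_ j)[]]] := hE. Qed.

Lemma measurable_Im_pairing j g :
  measurable_fun setT (fun l : measurableTypeR R => complex.Im (pairing j g l)).
Proof. by have [/(_ g)[_ /(_ j)[]]] := hE. Qed.

Lemma measurable_weight j :
  measurable_fun setT (fun l : measurableTypeR R => weight j l).
Proof.
pose v (x : R) := (1 + pi / 2 * `|x|)^-1.
have cv : continuous v.
  move=> x; apply: cvgV.
    by rewrite gt_eqF// ltr_pwDl// mulr_ge0// divr_ge0// pi_ge0.
  apply: cvgD; first exact: cvg_cst.
  by apply: cvgM; [exact: cvg_cst|exact: norm_continuous].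
exact: (measurableT_comp (continuous_measurable_fun cv) (measurable_Re_pairing j _)).
Qed.

Definition weighted_sqr j (f : R -> R[i]) l : R := cabs (f l) ^+ 2 * weight j l.

Lemma weighted_sqr_ge0 j (u : R -> R[i]) l : 0 <= weighted_sqr j u l.
Proof. by rewrite mulr_ge0 ?sqr_ge0// ltW// weight_gt0. Qed.

Lemma measurable_weighted_sqr j (f : R -> R[i]) :
  measurable_fun setT (fun l : measurableTypeR R => complex.Re (f l)) ->
  measurable_fun setT (fun l : measurableTypeR R => complex.Im (f l)) ->
  measurable_fun setT (fun l : measurableTypeR R => weighted_sqr j f l).
Proof.
move=> mRe mIm; apply: measurable_funM (measurable_weight j).
rewrite (_ : (fun l => _) =
  (fun l : measurableTypeR R => complex.Re (f l) ^+ 2 + complex.Im (f l) ^+ 2)).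
  by apply: measurable_funD; exact: measurable_funX.
by apply/funext => l; rewrite cabs_sqr.
Qed.

(** Cauchy-Schwarz in the fiber, and [|phi_j|^2 / (1 + (pi / 2) |phi_j|^2) <= 1] because
    [pi / 2 >= 1]. *)
Lemma integral_weighted_pairing (M : R) j g :
  (forall g, (\int[lebesgue_measure]_l l2_normsq (E g l) <= (M * rnorm g ^+ 2)%:E)%E) ->
  (\int[lebesgue_measure]_l (weighted_sqr j (pairing j g) l)%:E <= (M * rnorm g ^+ 2)%:E)%E.
Proof.
move=> hM; apply: le_trans (hM g); apply: ae_le_lower_integral.
- by move=> l; rewrite lee_fin weighted_sqr_ge0.
- by move=> l; exact: l2_normsq_ge0.
have := pairing_phi j; apply: ae_imply => l hl.
rewrite l2_normsq_fin// lee_fin /weighted_sqr /weight hl/=.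
have n0 := rnormsq_ge0 (sphi j l); have m0 := rnormsq_ge0 (square_summable_E g l).
rewrite ger0_norm// ler_pdivrMr; last first.
  by rewrite ltr_pwDl// mulr_ge0// divr_ge0// pi_ge0.
apply: le_trans (l2_cauchy_schwarz (square_summable_E g l) (sphi j l)) _.
apply: ler_wpM2l => //; have p2 : 1 <= pi / 2 :> R.
  by rewrite ler_pdivlMr// mul1r pi_ge2.
have := ler_wpM2r n0 p2; lra.
Qed.

(** At a point where [phi_at_inner] applies, [poisson_lim] is [pi] times the inner product in the
    fiber, and [multiplication_defect_bound] reads in terms of [pairing]. Its left-hand side carries
    the factor [(pi / 2)^2 >= 1], which is dropped. *)
Lemma approximate_multiplication (N : nat) f (c c' : nat -> R[i]) m j
    (s s' : nat -> R -> R) :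
  op_dom H0 f ->
  let g := \sum_(0 <= i < m) c i *: phi F i in
  let g' := \sum_(0 <= i < m) c' i *: phi F i in
  (forall n l, 0 <= s n l) -> (forall n l, 0 <= s' n l) ->
  (forall n l, - N%:R <= l < N%:R ->
    complex.Re (smooth_form H0 l n.+1%:R^-1 (g - f) (g - f)) <= s n l) ->
  (forall n l, - N%:R <= l < N%:R ->
    complex.Re (smooth_form H0 l n.+1%:R^-1 (g' - H0 f) (g' - H0 f)) <= s' n l) ->
  {ae lebesgue_measure, forall l : R, - N%:R <= l < N%:R ->
    ((weighted_sqr j (fun l => pairing j g' l - l%:C * pairing j g l) l)%:E <=
    limn_einf (fun n => (2 * s' n l + 2 * N%:R ^+ 2 * s n l)%:E))%E}.
Proof.
move=> df g g' s0 s'0 hs hs'.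
apply: ae_imply3 (pairing_sum j c m) (pairing_sum j c' m) (pairing_phi j).
move=> l; rewrite -/g -/g' => Eg Eg' Ephi lN.
have q0 n : 0 <= 2 * s' n l + 2 * N%:R ^+ 2 * s n l.
  by apply: addr_ge0; rewrite mulr_ge0// mulr_ge0// sqr_ge0.
(* In the remaining case every [phi_at] vanishes at [l] and the left-hand side is 0: this covers the
   points outside [Lambda] and those where [sqrt_mat] takes its default value. *)
have [[Ll nz]|triv] := pselect (Lambda H0 F l /\ exists j, phi_at H0 F j l <> fun=> 0);
  last first.
  have phi0 i : phi_at H0 F i l = fun=> 0.
    apply: contrapT => nz; apply: triv; split; last by exists i.
    by apply: contrapT => Ll; apply: nz; apply/funext => k; rewrite /phi_at asboolF.
  rewrite /weighted_sqr /pairing phi0 !l2_inner0r mulr0 subrr rnorm0 expr0n mul0r.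
  by apply: limn_einf_ge => n; rewrite lee_fin.
have GE i : poisson_lim H0 F l i j =
    pi%:C * l2_inner (phi_at H0 F i l) (phi_at H0 F j l).
  rewrite (phi_at_inner Ll nz) mulrA -real_complexM mulfV ?mul1r//.
  by rewrite gt_eqF// pi_gt0.
have lN' : `|l| <= N%:R.
  by move: lN => /andP[? ?]; rewrite ler_norml; apply/andP; split => //; exact: ltW.
have := @multiplication_defect_bound _ _ _ _ F hH0 l N%:R f c c' m j
  (s^~ l) (s'^~ l) Ll df lN' (fun n => hs n l lN)
  (fun n => hs' n l lN).
apply: le_trans; rewrite lee_fin /weighted_sqr.
rewrite Eg Eg'.
under [X in _ <= cabs (2^-1 * (X - _)) ^+ 2 / _]eq_bigr do rewrite GE mulrCA.
under [X in _ <= cabs (2^-1 * (_ - _ * X)) ^+ 2 / _]eq_bigr do rewrite GE mulrCA.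
rewrite -!mulr_sumr [l%:C * (pi%:C * _)]mulrCA -mulrBr mulrA.
set X := _ - _ * _; rewrite GE l2_innerxx//.
set G := rnormsq _; have G0 : 0 <= G := rnormsq_ge0 (sphi j l).
have -> : (2^-1 * pi%:C : R[i]) = (pi / 2)%:C.
  by rewrite mulrC real_complexM fmorphV/= rmorph_nat.
rewrite mulrA.
have -> : (2^-1 * pi%:C : R[i]) = (pi / 2)%:C.
  by rewrite mulrC real_complexM fmorphV/= rmorph_nat.
rewrite cabsM cabsR ReM_real/= /weight Ephi/= (ger0_norm G0).
have p2 : 1 <= pi / 2 :> R by rewrite ler_pdivlMr// mul1r pi_ge2.
rewrite ger0_norm; last by rewrite divr_ge0// pi_ge0.
apply: ler_wpM2r.
  by rewrite invr_ge0 addr_ge0// mulr_ge0// divr_ge0// pi_ge0.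
by rewrite exprMn ler_peMl ?sqr_ge0// exprn_ege1.
Unshelve. all: by end_near. Qed.

(** The weighted square [Psi] of the defect has integral at most [C e] for every [e > 0], with [C]
    depending on [N] and [M] only. The weight being positive, the defect itself vanishes almost
    everywhere on the interval. *)
Lemma pairing_mul_itv (N : nat) f j : op_dom H0 f ->
  {ae lebesgue_measure, forall l : R, - N%:R <= l < N%:R ->
    pairing j (H0 f) l = l%:C * pairing j f l}.
Proof.
move=> df.
have [M M0 hM] : exists2 M : R, 0 <= M & forall g,
    (\int[lebesgue_measure]_l l2_normsq (E g l) <= (M * rnorm g ^+ 2)%:E)%E.
  have [_ _ [M hM] _] := hE; exists `|M| => // g; apply: le_trans (hM g) _.
  by rewrite lee_fin ler_wpM2r ?sqr_ge0// ler_norm.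
pose defect (l : R) := pairing j (H0 f) l - l%:C * pairing j f l.
pose D : set (measurableTypeR R) := [set` `[- N%:R, N%:R[ : interval R].
have mD : measurable D by exact: measurable_itv.
pose Psi (l : measurableTypeR R) : R := weighted_sqr j defect l * \1_D l.
have wsqr0 u l : 0 <= weighted_sqr j u l by exact: weighted_sqr_ge0.
have Psi0 l : 0 <= Psi l by rewrite mulr_ge0// indicE.
have mRe g : measurable_fun setT
    (fun l : measurableTypeR R => complex.Re (pairing j g l)).
  exact: measurable_Re_pairing.
have mIm g : measurable_fun setT
    (fun l : measurableTypeR R => complex.Im (pairing j g l)).
  exact: measurable_Im_pairing.
have mdefect g g' :
    measurable_fun setT (fun l : measurableTypeR R =>
      weighted_sqr j (fun l => pairing j g' l - l%:C * pairing j g l) l).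
  apply: measurable_weighted_sqr.
    rewrite (_ : (fun l => _) = (fun l : measurableTypeR R =>
      complex.Re (pairing j g' l) - (l : R) * complex.Re (pairing j g l))).
      by apply: measurable_funB => //; apply: measurable_funM => //; exact: measurable_id.
    by apply/funext => l; rewrite ReD ReN ReM_real.
  rewrite (_ : (fun l => _) = (fun l : measurableTypeR R =>
    complex.Im (pairing j g' l) - (l : R) * complex.Im (pairing j g l))).
    by apply: measurable_funB => //; apply: measurable_funM => //; exact: measurable_id.
  by apply/funext => l; rewrite ImD ImN ImM_real.
have mPsi : measurable_fun setT Psi.
  by apply: measurable_funM; [exact: mdefect|exact: measurable_indic].
(* The factor 3 is that of [(x + y + z)^2 <= 3 (x^2 + y^2 + z^2)]. The three terms are the errors
   [H0 f - g'] and [f - g] seen through [E], the latter with [|l| <= N], and the defect of [g] and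
   [g'], bounded with the constant 768 of [smooth_form_majorant]. *)
pose C := 3 * M + 3 * N%:R ^+ 2 * M + 3 * (2 + 2 * N%:R ^+ 2) * 768.
have C0 : 0 <= C.
  have := sqr_ge0 (N%:R : R); rewrite /C; move: (N%:R ^+ 2 : R) => n2 n20.
  by have := mulr_ge0 n20 M0; nra.
have small (e : R) : 0 < e ->
    (\int[lebesgue_measure]_l (Psi l)%:E <= (C * e)%:E)%E.
  move=> e0.
  pose c g i := inner (phi F i) g.
  pose S g m := \sum_(0 <= i < m) c g i *: phi F i.
  have cvgS g : rnorm (g - S g m) ^+ 2 @[m --> \oo] --> (0 : R).
    have /cvg_rnormP h := (phi_basis F).2 g.
    rewrite -(mul0r 0); under eq_cvg do rewrite rdistrC.
    exact: (cvgM h h).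
  (* The same [m] serves for [f] and [H0 f], as [approximate_multiplication] takes two combinations
     of equal length. *)
  have [m [hf hf']] : exists m, rnorm (f - S f m) ^+ 2 <= e /\
      rnorm (H0 f - S (H0 f) m) ^+ 2 <= e.
    near \oo => m; exists m; split; near: m.
      exact: (cvgr_le _ (cvgS f) _ e0).
    exact: (cvgr_le _ (cvgS (H0 f)) _ e0).
  set g := S f m in hf; set g' := S (H0 f) m in hf'.
  have [s [ms s0 hs Is]] := smooth_form_majorant hH0 N (g - f).
  have [s' [ms' s'0 hs' Is']] := smooth_form_majorant hH0 N (g' - H0 f).
  pose q n l := 2 * s' n l + 2 * N%:R ^+ 2 * s n l.
  have q0 n l : 0 <= q n l.
    by apply: addr_ge0; rewrite mulr_ge0// mulr_ge0// sqr_ge0.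
  have mq n : measurable_fun setT (q n).
    by apply: measurable_funD; apply: measurable_funM;
      [exact: measurable_cst|exact: ms'|exact: measurable_cst|exact: ms].
  pose Q (l : measurableTypeR R) := limn_einf (fun n => (q n l)%:E).
  have Q0 l : (0 <= Q l)%E by apply: limn_einf_ge => n; rewrite lee_fin; exact: q0.
  have mQ : measurable_fun setT Q.
    by apply: measurable_limn_einf => n; apply/measurable_EFinP; exact: mq.
  have IQ : (\int[lebesgue_measure]_l Q l <= ((2 + 2 * N%:R ^+ 2) * 768 * e)%:E)%E.
    apply: (@le_trans _ _ (limn_einf (fun n =>
        \int[lebesgue_measure]_l (q n l)%:E)%E)).
      apply: (@fatou _ _ R lebesgue_measure setT measurableT
        (fun n (l : measurableTypeR R) => (q n l)%:E)).
      - by move=> n; apply/measurable_EFinP; exact: mq.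
      - by move=> n l _; rewrite lee_fin; exact: q0.
    apply: limn_einf_le => n; rewrite /q; under eq_integral do rewrite EFinD !EFinM.
    rewrite ge0_integralD//; last 4 first.
    - by move=> l _; rewrite -EFinM lee_fin mulr_ge0//; exact: s'0.
    - apply/measurable_EFinP.
      by apply: measurable_funM; [exact: measurable_cst|exact: ms'].
    - by move=> l _; rewrite -!EFinM lee_fin !mulr_ge0 ?sqr_ge0//; exact: s0.
    - apply/measurable_EFinP.
      by apply: measurable_funM; [exact: measurable_cst|exact: ms].
    rewrite ge0_integralZl_EFin//; last 2 first.
    - by move=> l _; rewrite lee_fin; exact: s'0.
    - by apply/measurable_EFinP; exact: ms'.
    under [X in (_ + X)%E]eq_integral do rewrite -EFinM.
    rewrite ge0_integralZl_EFin//; last 2 first.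
    - by move=> l _; rewrite lee_fin; exact: s0.
    - by apply/measurable_EFinP; exact: ms.
    apply: (@le_trans _ _ (2%:E * (768 * e)%:E +
        (2 * N%:R ^+ 2)%:E * (768 * e)%:E)%E).
      apply: leeD; apply: lee_wpmul2l; rewrite ?lee_fin ?mulr_ge0 ?sqr_ge0//.
        apply: le_trans (Is' n) _; rewrite lee_fin.
        by apply: ler_wpM2l; [exact: ler0n|rewrite rdistrC; exact: hf'].
      apply: le_trans (Is n) _; rewrite lee_fin.
      by apply: ler_wpM2l; [exact: ler0n|rewrite rdistrC; exact: hf].
    by rewrite -!EFinM -EFinD lee_fin le_eqVlt; apply/orP; left; apply/eqP; ring.
  pose u1 (l : measurableTypeR R) := weighted_sqr j (pairing j (H0 f - g')) l.
  pose u2 (l : measurableTypeR R) := weighted_sqr j (pairing j (f - g)) l.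
  have u10 l : (0 <= (u1 l)%:E)%E by rewrite lee_fin; exact: wsqr0.
  have u20 l : (0 <= (u2 l)%:E)%E by rewrite lee_fin; exact: wsqr0.
  have mu1 : measurable_fun setT u1 by exact: measurable_weighted_sqr.
  have mu2 : measurable_fun setT u2 by exact: measurable_weighted_sqr.
  have Iu1 : (\int[lebesgue_measure]_l (u1 l)%:E <= (M * e)%:E)%E.
    apply: le_trans (integral_weighted_pairing j (H0 f - g') hM) _.
    by rewrite lee_fin ler_wpM2l.
  have Iu2 : (\int[lebesgue_measure]_l (u2 l)%:E <= (M * e)%:E)%E.
    apply: le_trans (integral_weighted_pairing j (f - g) hM) _.
    by rewrite lee_fin ler_wpM2l.
  pose bnd (l : measurableTypeR R) : \bar R :=
    (3%:E * (u1 l)%:E + ((3 * N%:R ^+ 2)%:E * (u2 l)%:E + 3%:E * Q l))%E.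
  have N2 : 0 <= 3 * N%:R ^+ 2 :> R by rewrite mulr_ge0// sqr_ge0.
  have t1 l : (0 <= 3%:E * (u1 l)%:E)%E by apply: mule_ge0 (u10 l).
  have t2 l : (0 <= (3 * N%:R ^+ 2)%:E * (u2 l)%:E)%E.
    by apply: mule_ge0 (u20 l); rewrite lee_fin.
  have t3 l : (0 <= 3%:E * Q l)%E by apply: mule_ge0 (Q0 l).
  have t23 l := adde_ge0 (t2 l) (t3 l).
  have bnd0 l : (0 <= bnd l)%E := adde_ge0 (t1 l) (t23 l).
  apply: (@le_trans _ _ (\int[lebesgue_measure]_l bnd l)%E).
    apply: ae_le_lower_integral.
    - by move=> l; rewrite lee_fin; exact: Psi0.
    - exact: bnd0.
    apply: ae_imply3 (pairing_lin j 1 (H0 f - g') g') (pairing_lin j 1 (f - g) g)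
      (approximate_multiplication j df s0 s'0 hs hs').
    move=> l; rewrite !scale1r !subrK conjc1 !mul1r => E1 E2 E3.
    rewrite /Psi indicE; case: (boolP (l \in D)) => [lD|_]; last first.
      by rewrite mulr0; exact: bnd0.
    rewrite mulr1; have lN : - N%:R <= l < N%:R by move: lD; rewrite inE /D/= in_itv.
    have lN' : `|l| <= N%:R.
      by move: lN => /andP[? ?]; rewrite ler_norml; apply/andP; split => //; exact: ltW.
    have {}E3 := E3 lN.
    pose X l := pairing j g' l - l%:C * pairing j g l.
    apply: (@le_trans _ _ (3%:E * (u1 l)%:E +
      ((3 * N%:R ^+ 2)%:E * (u2 l)%:E + 3%:E * (weighted_sqr j X l)%:E))%E); last first.
      apply: leeD => //; apply: leeD => //; apply: lee_wpmul2l E3.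
      by rewrite lee_fin.
    rewrite -!EFinM -!EFinD lee_fin /u1 /u2 /weighted_sqr /defect.
    set w := weight _ _; have w0 : 0 <= w by rewrite ltW// weight_gt0.
    rewrite E1 E2.
    set a := pairing j (H0 f - g') l; set b := pairing j (f - g) l.
    have -> : a + pairing j g' l - l%:C * (b + pairing j g l) = a - l%:C * b + X l.
      by rewrite /X; ring.
    rewrite !mulrA -!mulrDl; apply: ler_wpM2r => //.
    set x := cabs a; set y := cabs b; set z := cabs (X l).
    have xyz : cabs (a - l%:C * b + X l) <= x + N%:R * y + z.
      apply: le_trans (ler_cabsD _ _) _; apply: lerD => //.
      apply: le_trans (ler_cabsD _ _) _; rewrite cabsN cabsM cabsR.
      by apply: lerD => //; apply: ler_wpM2r => //; exact: rnorm_ge0.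
    apply: (@le_trans _ _ ((x + N%:R * y + z) ^+ 2)).
      by rewrite lerXn2r// nnegrE ?addr_ge0 ?mulr_ge0 ?rnorm_ge0.
    have := sqr_ge0 (x - N%:R * y); have := sqr_ge0 (x - z).
    by have := sqr_ge0 (N%:R * y - z); lra.
  have Emu1 := (measurable_EFinP _ _).2 mu1.
  have Emu2 := (measurable_EFinP _ _).2 mu2.
  have m1 := measurable_funeM 3%:E Emu1.
  have m2 := measurable_funeM (3 * N%:R ^+ 2)%:E Emu2.
  have m3 := measurable_funeM 3%:E mQ.
  rewrite (ge0_integralD lebesgue_measure measurableT (fun l _ => t1 l) m1
    (fun l _ => t23 l) (emeasurable_funD m2 m3)).
  rewrite (ge0_integralD lebesgue_measure measurableT (fun l _ => t2 l) m2
    (fun l _ => t3 l) m3).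
  rewrite (ge0_integralZl_EFin lebesgue_measure measurableT (fun l _ => u10 l) Emu1
    (ler0n _ 3)).
  rewrite (ge0_integralZl_EFin lebesgue_measure measurableT (fun l _ => u20 l) Emu2 N2).
  rewrite (ge0_integralZl_EFin lebesgue_measure measurableT (fun l _ => Q0 l) mQ
    (ler0n _ 3)).
  apply: (@le_trans _ _ (3%:E * (M * e)%:E + ((3 * N%:R ^+ 2)%:E * (M * e)%:E +
     3%:E * ((2 + 2 * N%:R ^+ 2) * 768 * e)%:E))%E).
    have three0 : (0 <= 3%:E :> \bar R)%E by rewrite lee_fin ler0n.
    have N20 : (0 <= (3 * N%:R ^+ 2)%:E :> \bar R)%E by rewrite lee_fin.
    exact: (leeD (lee_wpmul2l three0 Iu1)
      (leeD (lee_wpmul2l N20 Iu2) (lee_wpmul2l three0 IQ))).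
  rewrite -!EFinM -!EFinD lee_fin le_eqVlt; apply/orP; left; apply/eqP.
  by rewrite /C; ring.
have I0 : (\int[lebesgue_measure]_l `|(Psi l)%:E| = 0)%E.
  under eq_integral => l _ do rewrite gee0_abs ?lee_fin ?Psi0//.
  apply/eqP; rewrite eq_le; apply/andP; split; last first.
    by apply: integral_ge0 => l _; rewrite lee_fin; exact: Psi0.
  apply/lee_addgt0Pr => e e0; rewrite add0e.
  have C1 : 0 < C + 1 by rewrite ltr_wpDl.
  apply: le_trans (small _ (divr_gt0 e0 C1)) _.
  rewrite lee_fin mulrA ler_pdivrMr// mulrC ler_wpM2l// ?(ltW e0)//.
  by rewrite lerDl.
have := (ae_eq_integral_abs lebesgue_measure measurableT
  ((measurable_EFinP setT Psi).2 mPsi)).1 I0.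
apply: ae_imply => l /(_ Logic.I) [] + lN.
rewrite /Psi indicE mem_set/=; last by rewrite /D/= in_itv.
rewrite mulr1 => /eqP; rewrite mulf_eq0 sqrf_eq0 [weight _ _ == 0]gt_eqF ?weight_gt0//.
by rewrite orbF => /eqP/cabs_eq0/subr0_eq.
Unshelve. all: by end_near. Qed.

(** There are countably many [j] and [N], so one null set serves for all. Off it, the difference [w]
    of the two sides is orthogonal to every [phi_at], hence to [E f l] and [E (H0 f) l], which lie
    in the fiber; so [<w, w> = 0]. *)
Lemma evaluation_mul f : op_dom H0 f ->
  {ae lebesgue_measure, forall l : R, E (H0 f) l = multiply (E f) l}.
Proof.
move=> df.
have h := ae_foralln (fun j => ae_foralln (fun N => pairing_mul_itv N j df)).
apply: ae_imply h => l hl.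
have [Efib _ _ _] := hE.
have [fib1 _ _] := Efib (H0 f); have [fib2 _ _] := Efib f.
have s1 := (fib1 l).1; have s2 := (fib2 l).1.
pose w k := (- l%:C) * E f l k + E (H0 f) l k.
have sw : square_summable w by exact: square_summable_comb.
have orth j : l2_inner (phi_at H0 F j l) w = 0.
  rewrite l2_innerJ// l2_inner_comb//.
  pose N := (Num.truncn `|l|).+1.
  have lN : - N%:R <= l < N%:R.
    have /andP[_ h1] := truncn_itv (normr_ge0 l).
    move: (h1); rewrite ltr_norml => /andP[h2 h3].
    by rewrite (ltW h2) h3.
  have := hl j N lN; rewrite /pairing => ->.
  by rewrite conjcN conjc_real mulNr addNr conjc0.
have o1 := closed_span_orthogonal (sphi^~ l) (fib1 l) sw orth.
have o2 := closed_span_orthogonal (sphi^~ l) (fib2 l) sw orth.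
have ww : l2_inner w w = 0 by rewrite {1}/w l2_inner_comb// o1 o2 mulr0 addr0.
have w0 : w = fun=> 0.
  by apply: rnormsq_eq0 => //; move: ww; rewrite l2_innerxx// => /complexI.
apply/funext => k; have := congr1 (fun u => u k) w0.
by rewrite /w /multiply mulNr => /eqP; rewrite addrC subr_eq0 => /eqP.
Qed.

End Evaluation.

(** * The absolutely continuous part *)

Section AbsolutelyContinuousSubspace.
Context (R : realType) (V : hilbertType R) (A : operator V).

(** [<x, P D x> = |P D x|^2] for a projection, so absolute continuity amounts to linear conditions
    on [x]. This form shows that [ac_subspace] is a closed linear subspace. *)
Lemma ac_subspaceP x : ac_subspace A x <->
  forall P, spectral_measure A P -> forall D, measurable D ->
    lebesgue_measure (D : set R) = 0%E -> P D x = 0.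
Proof.
have normP P D y : spectral_measure A P -> measurable D ->
    inner y (P D y) = (rnorm (P D y) ^+ 2)%:C.
  by move=> [[_ Pid Psym _ _] _] mD; rewrite -innerxx Psym// Pid.
split=> [acx P AP D mD D0|h P AP N Nnull D mD DN].
  have /(acx P AP) : (@lebesgue_measure R).-null_set D.
    by apply: negligible_null_set; exists D; split => //.
  move=> /(_ D mD (@subset_refl _ D)); rewrite /measure_at normP//= => -[] /eqP.
  by rewrite sqrf_eq0 => /eqP/rnorm0_eq0.
by rewrite /measure_at (h P AP D mD (Nnull D mD DN)) inner0r.
Qed.

Lemma ac_subspace0 : ac_subspace A 0.
Proof.
apply/ac_subspaceP => P [[Plin _ _ _ _] _] D mD _.
have := Plin D mD (-1) 0 0.
by rewrite scaler0 addr0 scaleN1r addNr.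
Qed.

Lemma ac_subspace_comb (a : R[i]) x y :
  ac_subspace A x -> ac_subspace A y -> ac_subspace A (a *: x + y).
Proof.
move=> /ac_subspaceP hx /ac_subspaceP hy; apply/ac_subspaceP => P AP D mD D0.
have [[Plin _ _ _ _] _] := AP.
by rewrite (Plin D mD) (hx P AP)// (hy P AP)// scaler0 addr0.
Qed.

Lemma ac_subspace_closed (u : nat -> V) x :
  (forall n, ac_subspace A (u n)) -> u @ \oo --> x -> ac_subspace A x.
Proof.
move=> hu ux; apply/ac_subspaceP => P AP D mD D0.
have [[_ _ Psym _ _] _] := AP.
apply: inner_eq0 => y; rewrite -Psym//.
pose proof (cvg_innerr (y := P D y) ux) as h.
apply: (complex_cvg_unique h); apply: cvg_near_cst; near=> n.
by rewrite Psym// ((ac_subspaceP (u n)).1 (hu n) P AP D mD D0) inner0r.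
Unshelve. all: by end_near. Qed.

Lemma ac_decomposition x :
  exists2 p, ac_subspace A p & singular_subspace A (x - p).
Proof.
exact: (orthogonal_projection ac_subspace0 ac_subspace_comb ac_subspace_closed).
Qed.

End AbsolutelyContinuousSubspace.

(** * The domain of [H0] on the absolutely continuous subspace *)

Section UnitaryPart.
Context (R : realType) (H K : hilbertType R) (H0 : operator H) (F : frame H K).
Context (E : H -> R -> nat -> R[i]).
Hypotheses (hH0 : self_adjoint H0) (hE : evaluation_operator H0 F E).
Hypothesis hU : unitary_on_ac H0 F E.
Implicit Types (f g h u v x : H) (l : R).

(** The graph of multiplication by [l], pulled back along [E]; it makes sense before [f] is known to
    lie in the domain of [H0]. *)
Definition multiplication_pair f g :=
  {ae lebesgue_measure, forall l : R, E g l = multiply (E f) l}.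

Lemma multiplication_pair_comb (a : R[i]) f g u v :
  multiplication_pair f g -> multiplication_pair u v ->
  multiplication_pair (a *: u + f) (a *: v + g).
Proof.
have [_ Elin _ _] := hE.
move=> fg uv; have h := ae_imply2 (fun l p q => conj p q) (Elin a u f) (Elin a v g).
apply: ae_imply3 fg uv h => l fg uv [eu ev].
by rewrite ev fg uv; apply/funext => k; rewrite /multiply eu; ring.
Qed.

Lemma multiplication_pair_Im f g :
  ac_subspace H0 f -> ac_subspace H0 g -> multiplication_pair f g ->
  complex.Im (inner g f) = 0.
Proof.
move=> acf acg fg; have [_ Elin _ _] := hE; have [_ iso _] := hU.
pose p := 'i *: f + g; pose m := (- 'i) *: f + g.
have : (\int[lebesgue_measure]_l l2_normsq (E p l) =
    \int[lebesgue_measure]_l l2_normsq (E m l))%E.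
  apply: ae_eq_lower_integral.
  - by move=> l; exact: l2_normsq_ge0.
  - by move=> l; exact: l2_normsq_ge0.
  apply: ae_imply3 fg (Elin 'i f g) (Elin (- 'i) f g) => l {}fg Ep Em.
  rewrite !l2_normsqE Ep Em fg; apply: eq_eseriesr => k _; congr (_%:E).
  (* [E p l] and [E m l] are [(l + i) E f l] and [(l - i) E f l], and [|l + i| = |l - i|] for real
     [l]. *)
  rewrite /multiply -!mulrDl !cabsM !exprMn; congr (_ * _).
  by rewrite !cabs_sqr/=; ring.
rewrite !iso; try exact: ac_subspace_comb.
rewrite /p /m => -[] /eqP; rewrite !rnorm_sqrD !rnormZ !innerZl cabsN.
rewrite (inner_conj f g) => /eqP; case: (inner g f) => a b /=; lra.
Qed.

(** Multiplication pairs are stable under combinations, so [multiplication_pair_Im] applies to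
    [c u + f]. The value [c = 1] compares imaginary parts and [c = i] real parts. *)
Lemma multiplication_pair_adj f g u v :
  ac_subspace H0 f -> ac_subspace H0 g -> ac_subspace H0 u -> ac_subspace H0 v ->
  multiplication_pair f g -> multiplication_pair u v ->
  inner v f = inner u g.
Proof.
move=> acf acg acu acv fg uv.
have hc (c : R[i]) : complex.Im (c * inner g u + conjc c * inner v f) = 0.
  have Ifg := multiplication_pair_Im acf acg fg.
  have Iuv := multiplication_pair_Im acu acv uv.
  have := multiplication_pair_Im (ac_subspace_comb c acu acf)
    (ac_subspace_comb c acv acg) (multiplication_pair_comb c fg uv).
  rewrite innerDl !innerDr !innerZl !innerZr mulrA mulJc !ImD Ifg ImM_real Iuv.
  by rewrite mulr0 addr0 add0r addrC.
have := hc 1; have := hc 'i; rewrite (inner_conj u g).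
case: (inner g u) (inner v f) => [a b] [c d] /= h1 h2.
by apply/eqP; rewrite eq_complex/=; apply/andP; split; apply/eqP; lra.
Qed.

Lemma evaluation_ac_part x p : singular_subspace H0 (x - p) ->
  {ae lebesgue_measure, forall l : R, E x l = E p l}.
Proof.
move=> sx; have [_ Elin _ _] := hE; have [van _ _] := hU.
have := Elin 1 (x - p) p; rewrite scale1r subrK.
move=> h; apply: ae_imply2 h (van _ sx) => l -> ->.
by apply/funext => k; rewrite mulr0 add0r.
Qed.

(** The absolutely continuous parts [u] of [x] and [v] of [H0 x] are taken separately. As [E]
    ignores singular parts, [evaluation_mul] makes [(u, v)] a multiplication pair; inner products
    with [f] and [g] see only [u] and [v]. *)
Lemma multiplication_pair_op f g :
  ac_subspace H0 f -> ac_subspace H0 g -> multiplication_pair f g ->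
  op_dom H0 f /\ H0 f = g.
Proof.
move=> acf acg fg; apply/(hH0.2 f g) => x dx.
have [u acu su] := ac_decomposition H0 x.
have [v acv sv] := ac_decomposition H0 (H0 x).
have uv : multiplication_pair u v.
  apply: ae_imply3 (evaluation_mul hH0 hE dx) (evaluation_ac_part su)
    (evaluation_ac_part sv) => l e1 e2 e3.
  by rewrite -e3 e1 /multiply e2.
have -> : inner (H0 x) f = inner v f.
  by apply/subr0_eq; rewrite -innerBl inner_conj sv// conjc0.
have -> : inner x g = inner u g.
  by apply/subr0_eq; rewrite -innerBl inner_conj su// conjc0.
exact: multiplication_pair_adj.
Qed.

(** Membership in the fibers and measurability are required of the representative [multiply (E f)]
    at every [l] and are checked on it directly; finiteness of the integral is inherited from
    [E (H0 f)], equal to it almost everywhere. *)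
Lemma multiply_dom_evaluation f : op_dom H0 f -> multiply_dom H0 F (E f).
Proof.
move=> df; have [Edi _ _ _] := hE; split; first exact: Edi.
have [fib mE _] := Edi f.
have sphi j l : square_summable (phi_at H0 F j l) by exact: square_summable_phi_at.
have inner_mul j l : l2_inner (multiply (E f) l) (phi_at H0 F j l) =
    l%:C * l2_inner (E f l) (phi_at H0 F j l).
  by rewrite (l2_innerZl l%:C (fib l).1 (sphi j l)) conjc_real.
split.
- by move=> l; exact: (closed_spanZ l%:C (sphi^~ l) (fib l)).
- move=> j; have [mRe mIm] := mE j; split.
    rewrite (_ : (fun l => _) = (fun l : measurableTypeR R =>
      (l : R) * complex.Re (l2_inner (E f l) (phi_at H0 F j l)))).
      by apply: measurable_funM => //; exact: measurable_id.
    by apply/funext => l; rewrite inner_mul ReM_real.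
  rewrite (_ : (fun l => _) = (fun l : measurableTypeR R =>
    (l : R) * complex.Im (l2_inner (E f l) (phi_at H0 F j l)))).
    by apply: measurable_funM => //; exact: measurable_id.
  by apply/funext => l; rewrite inner_mul ImM_real.
- have [_ _] := Edi (H0 f); apply: le_lt_trans.
  rewrite le_eqVlt; apply/orP; left; apply/eqP; apply: ae_eq_lower_integral.
  + by move=> l; exact: l2_normsq_ge0.
  + by move=> l; exact: l2_normsq_ge0.
  + by apply: ae_imply (evaluation_mul hH0 hE df) => l ->.
Qed.

(** Surjectivity of [E] provides an absolutely continuous [g] with [E g = multiply (E f)] almost
    everywhere, and this [g] is [H0 f]. *)
Lemma multiply_dom_op f : ac_subspace H0 f -> multiply_dom H0 F (E f) ->
  op_dom H0 f /\ ac_subspace H0 (H0 f).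
Proof.
move=> acf [_ mf]; have [_ _ onto] := hU.
have [g acg fg] := onto _ mf.
by have [df ->] := multiplication_pair_op acf acg fg.
Qed.

End UnitaryPart.

Theorem theorem4p19 (R : realType) (H K : hilbertType R) (H0 : operator H)
    (F : frame H K) (E : H -> R -> nat -> R[i])
    (hH0 : self_adjoint H0) (hE : evaluation_operator H0 F E) :
  (forall f, op_dom H0 f ->
     {ae lebesgue_measure, forall l : R, E (H0 f) l = multiply (E f) l}) /\
  (unitary_on_ac H0 F E -> forall f, ac_subspace H0 f ->
     (op_dom H0 f <-> multiply_dom H0 F (E f)) /\
     (op_dom H0 f -> ac_subspace H0 (H0 f))).
Proof.
split=> [f df|hU f acf]; first exact: (evaluation_mul hH0 hE df).
have to_dom df := multiply_dom_evaluation hH0 hE (f := f) df.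
have of_dom mf := multiply_dom_op hH0 hE hU acf mf.
by split; [split; [exact: to_dom|case/of_dom]|case/to_dom/of_dom].
Qed.
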